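(* Let $n\in\mathbb{N}$ and assume that the positive recurrent Markov chain $\xi_1,\xi_2,\ldots$, with transition kernel $p$, invariant probability measure $\pi$ and Markov operator $P$, is very weak reversible of order $n$. Then the following two conditions are equivalent: (1) $P$ has an $L^2(\pi)$-spectral gap. (2) $k_{2n}>0$.
   Context: Setting: $\xi_1,\xi_2,\ldots$ is a time-homogeneous, discrete-time, positive recurrent Markov chain on an arbitrary measurable state space $(\Omega,\mathcal{F})$ with transition kernel $p(x,dy)$, $n$-step kernels $p^n(x,dy)$, and uniquely determined invariant probability measure $\pi$. The Markov operator is $Pf(x)=\int_\Omega f(y)\,p(x,dy)$ on $L^2(\pi)$. Let $L^2_{0,1}(\pi)=\{f\in L^2(\pi):\int f\,d\pi=0,\ \int f^2\,d\pi=1\}$. $P$ has an $L^2(\pi)$-spectral gap if $\lim_{n\to\infty}\sup_{f\in L^2_{0,1}(\pi)}\|P^nf\|_2^{1/n}<1$. Let $Q^{(n)}$ be the measure on $\Omega^2$ with $Q^{(n)}(A\times B)=\int_A\pi(dx)\,p^n(x,B)$, and $\tilde Q^{(n)}$ the measure with $\tilde Q^{(n)}(A\times B)=Q^{(n)}(B\times A)$, i.e. $\tilde Q^{(n)}(dx,dy)=\pi(dy)p^n(y,dx)$. It is assumed that $Q^{(n)}$ and $\tilde Q^{(n)}$ are equivalent (mutually absolutely continuous). The chain is very weak reversible of order $n$ if there exists $q\in(1,\infty]$ such that $$\operatorname{ess\,sup}_{y\in\Omega}\left\|\frac{dQ^{(n)}}{d\tilde Q^{(n)}}(\cdot,y)\right\|_{L^q(p^n(y,\cdot))}<\infty,$$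 the essential supremum being with respect to $\pi$. Isoperimetric constants: for $m\in\mathbb{N}$, $k_m:=\inf_A\frac{1}{\pi(A)\pi(A^c)}\int_A p^m(x,A^c)\,\pi(dx)$, the infimum being over $A\in\mathcal{F}$ with $0<\pi(A)<1$. *)

(* Defs.v *)
From HB Require Import structures.
From mathcomp Require Import all_boot all_order all_algebra.
From mathcomp Require Import all_classical all_reals all_analysis.
From mathcomp Require Import measurable_realfun ess_sup_inf.

Set Implicit Arguments.
Unset Strict Implicit.
Unset Printing Implicit Defensive.

Import Order.TTheory GRing.Theory Num.Theory.
Import numFieldNormedType.Exports.

Local Open Scope classical_set_scope.
Local Open Scope ring_scope.
Local Open Scope ereal_scope.
Local Open Scope charge_scope.

Section probability_kcomp_noparam.
Context d0 d1 d2 (T0 : measurableType d0) (T1 : measurableType d1)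
  (T2 : measurableType d2) (R : realType).
Variables (k1 : R.-pker T0 ~> T1) (k2 : R.-pker T1 ~> T2).

Let mkcomp_noparam_setT x : mkcomp_noparam k1 k2 x [set: T2] = 1.
Proof.
rewrite /mkcomp_noparam/= /kcomp_noparam.
under eq_integral do rewrite prob_kernel.
by rewrite integral_cst// mul1e prob_kernel.
Qed.

HB.instance Definition _ := isProbabilityKernel.Build _ _ _ _ R
  (mkcomp_noparam k1 k2) mkcomp_noparam_setT.

End probability_kcomp_noparam.

Fixpoint nstep d (T : measurableType d) (R : realType) (p : R.-pker T ~> T)
    (n : nat) : R.-pker T ~> T :=
  if n is m.+1 then mkcomp_noparam p (nstep p m)
  else kdirac (@measurable_id _ T [set: T]).

Definition invariant_measure d (T : measurableType d) (R : realType)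
    (p : R.-pker T ~> T) (mu : probability T R) : Prop :=
  forall A, measurable A -> \int[mu]_x p x A = mu A.

Definition irreducible_wrt d (T : measurableType d) (R : realType)
    (p : R.-pker T ~> T) (phi : {sigma_finite_measure set T -> \bar R}) : Prop :=
  0 < phi [set: T] /\
  forall A, measurable A -> 0 < phi A ->
    forall x, exists2 n, (0 < n)%N & 0 < nstep p n x A.

(* Recurrence on a general state space: every set charged by the irreducibility
   measure phi has, from every starting point, an infinite expected number of
   visits. It is required for one irreducibility measure, which need not be
   maximal. *)
Definition recurrent d (T : measurableType d) (R : realType)
    (p : R.-pker T ~> T) : Prop :=
  exists phi : {sigma_finite_measure set T -> \bar R},
    irreducible_wrt p phi /\
    forall A, measurable A -> 0 < phi A ->
      forall x, \sum_(1 <= n <oo) nstep p n x A = +oo.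

(* Uniqueness is on measurable sets only: the values of a measure on
   non-measurable sets carry no information. *)
Definition positive_recurrent d (T : measurableType d) (R : realType)
    (p : R.-pker T ~> T) (mu : probability T R) : Prop :=
  [/\ recurrent p, invariant_measure p mu &
      forall nu : probability T R, invariant_measure p nu ->
        forall A, measurable A -> nu A = mu A].

Section joint_law.
Context d (T : measurableType d) (R : realType).
Variables (mu : probability T R) (k : R.-pker T ~> T).

(* The measure mu(dx) k(x, dy) on T * T. *)
Definition joint_law (C : set (T * T)) : \bar R :=
  \int[mu]_x k x (xsection C x).

Let measurable_section C : measurable C ->
  measurable_fun [set: T] (fun x => k x (xsection C x)).
Proof.
by move=> mC; apply: measurable_fun_xsection_finite_kernel; rewrite inE.
Qed.

Let joint_law0 : joint_law set0 = 0.
Proof. by apply: integral0_eq => x _; rewrite xsection0 measure0. Qed.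

Let joint_law_ge0 C : 0 <= joint_law C.
Proof. by apply: integral_ge0 => x _; exact: measure_ge0. Qed.

Let joint_law_sigma_additive : semi_sigma_additive joint_law.
Proof.
move=> F mF tF mUF.
rewrite /joint_law [X in _ --> X](_ : _ =
    \int[mu]_x (\sum_(n <oo) k x (xsection (F n) x))); last first.
  apply: eq_integral => x _; rewrite xsection_bigcup.
  apply/esym/cvg_lim => //; apply: measure_sigma_additive.
  - by move=> n; exact: measurable_xsection.
  - exact: trivIset_xsection.
apply/cvg_closeP; split.
  by apply: is_cvg_nneseries => n _ _; exact: integral_ge0.
rewrite closeE// integral_nneseries// => n.
exact: measurable_section.
Qed.

HB.instance Definition _ := isMeasure.Build _ _ R joint_law
  joint_law0 joint_law_ge0 joint_law_sigma_additive.

Let joint_law_setT : joint_law [set: T * T] = 1.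
Proof.
rewrite /joint_law (eq_integral (cst 1)).
  rewrite integral_cst// mul1e; exact: probability_setT.
move=> x _; rewrite (_ : xsection _ _ = [set: T]) ?prob_kernel//.
by apply/seteqP; split => // y _; rewrite /xsection/= inE.
Qed.

HB.instance Definition _ := Measure_isProbability.Build _ _ R joint_law
  joint_law_setT.

Lemma joint_lawX A B : measurable A -> measurable B ->
  joint_law (A `*` B) = \int[mu]_(x in A) k x B.
Proof.
move=> mA mB; rewrite /joint_law [RHS]integral_mkcond.
apply: eq_integral => x _; rewrite patchE; case: ifPn => xA.
  by rewrite in_xsectionX.
by rewrite notin_xsectionX// measure0.
Qed.

(* The measure mu(dy) k(y, dx) on T * T. *)
Definition reversed_law : set (T * T) -> \bar R :=
  pushforward joint_law swap_pair.

Let measurable_swap_preimage C : measurable C ->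
  measurable (@swap_pair T T @^-1` C).
Proof. by move=> mC; rewrite -[X in measurable X]setTI; exact: measurable_swap. Qed.

Let reversed_law0 : reversed_law set0 = 0.
Proof. by rewrite /reversed_law /pushforward preimage_set0 measure0. Qed.

Let reversed_law_ge0 C : 0 <= reversed_law C.
Proof. exact: joint_law_ge0. Qed.

Let reversed_law_sigma_additive : semi_sigma_additive reversed_law.
Proof.
move=> F mF tF mUF; rewrite /reversed_law /pushforward preimage_bigcup.
apply: measure_semi_sigma_additive.
- by move=> n; exact: measurable_swap_preimage.
- apply/trivIsetP => /= i j _ _ ij; rewrite -preimage_setI.
  by move/trivIsetP : tF => /(_ _ _ _ _ ij) ->//; rewrite preimage_set0.
- by rewrite -preimage_bigcup; exact: measurable_swap_preimage.
Qed.

HB.instance Definition _ := isMeasure.Build _ _ R reversed_law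
  reversed_law0 reversed_law_ge0 reversed_law_sigma_additive.

Let reversed_law_setT : reversed_law [set: T * T] = 1.
Proof. by rewrite /reversed_law /pushforward preimage_setT joint_law_setT. Qed.

HB.instance Definition _ := Measure_isProbability.Build _ _ R reversed_law
  reversed_law_setT.

Lemma reversed_lawX A B : reversed_law (A `*` B) = joint_law (B `*` A).
Proof.
by congr joint_law; apply/seteqP; split => -[x y] [].
Qed.

End joint_law.

Section markov_chain.
Context d (T : measurableType d) (R : realType).
Variables (p : R.-pker T ~> T) (mu : probability T R).

(* P acts on representatives. For f square integrable and mu invariant, f is
   integrable with respect to p x for mu-almost every x, and the values of
   Rintegral on the remaining null set do not affect the class of P f. *)
Definition markov_op (f : T -> R) : T -> R := fun x => (\int[p x]_y f y)%R.

Definition L2_normalized : set (T -> R) :=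
  [set f | [/\ f \in Lfun mu 2%:E,
               \int[mu]_x (f x)%:E = 0 &
               \int[mu]_x (f x ^+ 2)%:E = 1]].

(* If mu only takes the values 0 and 1, the supremum below is that of the empty
   set, -oo, and the spectral gap holds. *)
Definition L2_spectral_gap : Prop :=
  exists2 l : \bar R,
    (fun n : nat => ereal_sup
      [set 'N[mu]_2%:E [EFin \o iter n markov_op f] `^ (n%:R^-1)
         | f in L2_normalized]) @ \oo --> l
    & l < 1.

Definition step_law (n : nat) : probability (T * T)%type R :=
  joint_law mu (nstep p n).

Definition reversed_step_law (n : nat) : probability (T * T)%type R :=
  reversed_law mu (nstep p n).

Definition equivalent_step_laws (n : nat) : Prop :=
  step_law n `<< reversed_step_law n /\ reversed_step_law n `<< step_law n.

(* The library's Radon-Nikodym derivative is a chosen version. Two versions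
   differ on a set C with mu(dy) p^n(y, {x | C (x, y)}) = 0, hence have the same
   L^q(p^n(y, .)) norms for mu-almost every y. *)
Definition step_density (n : nat) : T * T -> \bar R :=
  'd (charge_of_finite_measure (step_law n)) '/d (reversed_step_law n).

Definition very_weak_reversible (n : nat) : Prop :=
  exists2 q : \bar R, 1 < q &
    ess_sup mu (fun y => 'N[nstep p n y]_q[(fun x => step_density n (x, y))])
      < +oo.

Definition isoperimetric_constant (m : nat) : \bar R :=
  ereal_inf [set (\int[mu]_(x in A) nstep p m x (~` A)) / (mu A * mu (~` A))
               | A in [set A | measurable A /\ 0 < mu A < 1]].

End markov_chain.

(* Main.v *)
Require Import Defs.
From HB Require Import structures.
From mathcomp Require Import all_boot all_order all_algebra.
From mathcomp Require Import all_classical all_reals all_analysis.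
From mathcomp Require Import measurable_realfun ess_sup_inf giry.
From mathcomp Require Import ring lra.

(* Write k = p^n, let k_y be the law of the chain n steps after y, and let S be
   the law of two points drawn independently from k_y with y distributed as mu;
   S is the reversible law attached to P^{n*} P^n.

   Isoperimetry implies gap.  The mass of p^{2n} from A to B is the integral of
   1_A(x) k(y, B) against Q^(n) = h . Q~^(n).  The uniform L^q bound on h(., y)
   gives, for every eps, a constant K such that
     int_A |h(., y)| dk_y <= K k(y, A) + eps,
   so that int_A p^{2n}(x, A^c) mu(dx) <= K S(A x A^c) + eps mu(A^c).  Choosing
   between A and its complement the one for which mu(A^c) <= 1/2 absorbs the
   last term, and k_{2n} > 0 yields S(A x A^c) >= c mu(A) mu(A^c).  Cheeger's
   inequality for S (a median, the coarea formula, AM-GM) bounds the Dirichlet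
   form of S, which is 2 (|f|^2 - |P^n f|^2), from below: |P^n|^2 < 1 on L^2_0.
   The limit of |P^m|^{1/m} exists by Fekete's argument.

   Gap implies isoperimetry.  By Chapman-Kolmogorov and invariance the mass
   leaving A in 2nj steps is at most j times the mass leaving it in 2n steps,
   and for large j it is at least (1 - |P^{2nj}|^2) / 2 times
   mu(A) mu(A^c). *)

Set Implicit Arguments.
Unset Strict Implicit.
Unset Printing Implicit Defensive.

Import Order.TTheory GRing.Theory Num.Theory.
Import numFieldNormedType.Exports.

Local Open Scope classical_set_scope.
Local Open Scope ring_scope.
Local Open Scope ereal_scope.

(** * Integrals against mixtures of kernels *)

Section kernel_integration.
Context d1 d2 (X : measurableType d1) (Y : measurableType d2) (R : realType).

(** On measurable sets [nu] is the Giry bind of [m] and [g], and integrals see nothing else. The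
    rule for integrating against a bind therefore transfers to any measure given by such a
    formula. *)
Lemma integral_bind (m : giry X R) (g : X -> giry Y R)
    (nu : {measure set Y -> \bar R}) (f : Y -> \bar R) :
  measurable_fun [set: X] g ->
  (forall A, measurable A -> nu A = \int[m]_x g x A) ->
  measurable_fun [set: Y] f -> (forall y, 0 <= f y) ->
  \int[nu]_y f y = \int[m]_x \int[g x]_y f y.
Proof.
move=> mg nuE mf f0.
rewrite (eq_measure_integral (giry_bind m mg)); first exact: giry_int_bind.
move=> A mA _; rewrite nuE// /giry_bind /= giry_int_map//.
exact: measurable_giry_ev.
Qed.

(* The value k x of a probability kernel is only a measure for type inference. *)
Definition kernel_prob (k : R.-pker X ~> Y) (x : X) : set Y -> \bar R := k x.

HB.instance Definition _ (k : R.-pker X ~> Y) (x : X) :=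
  Measure.copy (kernel_prob k x) (k x).
HB.instance Definition _ (k : R.-pker X ~> Y) (x : X) :=
  Measure_isProbability.Build _ _ _ (kernel_prob k x) (prob_kernel x).

Lemma kernel_probE (k : R.-pker X ~> Y) x :
  (kernel_prob k x : {measure set Y -> \bar R}) = k x.
Proof. exact: eq_measure. Qed.

Lemma measurable_kernel_prob (k : R.-pker X ~> Y) :
  measurable_fun [set: X] (kernel_prob k : X -> giry Y R).
Proof.
by apply: measurable_giry_codensity => // B mB; exact: measurable_kernel.
Qed.

Lemma integral_kernel_bind (m : probability X R) (k : R.-pker X ~> Y)
    (nu : {measure set Y -> \bar R}) (f : Y -> \bar R) :
  (forall A, measurable A -> nu A = \int[m]_x k x A) ->
  measurable_fun [set: Y] f -> (forall y, 0 <= f y) ->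
  \int[nu]_y f y = \int[m]_x \int[k x]_y f y.
Proof. by move=> *; exact: integral_bind (measurable_kernel_prob k) _ _ _. Qed.

Lemma measurable_integral_kernel (k : R.-pker X ~> Y) (f : Y -> \bar R) :
  measurable_fun [set: Y] f -> (forall y, 0 <= f y) ->
  measurable_fun [set: X] (fun x => \int[k x]_y f y).
Proof.
move=> mf f0; apply: measurable_fun_integral_kernel => //.
exact: measurable_kernel.
Qed.

End kernel_integration.

(** * Joint, reversed and sibling laws under the integral *)

Section joint_law_integration.
Context d (T : measurableType d) (R : realType).
Variables (mu : probability T R) (k : R.-pker T ~> T).

Lemma integral_joint_law (f : T * T -> \bar R) :
  measurable_fun [set: T * T] f -> (forall z, 0 <= f z) ->
  \int[joint_law mu k]_z f z = \int[mu]_x \int[k x]_y f (x, y).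
Proof.
move=> mf f0.
(* The joint law is the bind of [mu] with the image of [k x] under y |-> (x, y). *)
pose g x : giry (T * T)%type R :=
  giry_map (@measurable_pair1 _ _ T T x) (kernel_prob k x).
have gE x A : g x A = k x (xsection A x).
  by rewrite /g/= /pushforward xsectionE.
rewrite (@integral_bind _ _ _ _ _ mu g)//.
- by apply: eq_integral => x _; exact: giry_int_map.
- apply: measurable_giry_codensity => // B mB.
  under eq_fun do rewrite gE.
  by apply: measurable_fun_xsection_finite_kernel; rewrite inE.
- by move=> A mA; apply: eq_integral => x _; rewrite gE.
Qed.

Lemma integral_reversed_law (f : T * T -> \bar R) :
  measurable_fun [set: T * T] f -> (forall z, 0 <= f z) ->
  \int[reversed_law mu k]_z f z = \int[mu]_y \int[k y]_x f (x, y).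
Proof.
move=> mf f0.
rewrite ge0_integral_pushforward//; last exact: measurable_swap.
rewrite preimage_setT integral_joint_law//; last by move=> z; exact: f0.
by apply: (measurableT_comp mf); exact: measurable_swap.
Qed.

Let sibling (y : T) : giry (T * T)%type R :=
  giry_prod (kernel_prob k y : giry T R, kernel_prob k y : giry T R).

Let measurable_sibling : measurable_fun [set: T] sibling.
Proof.
apply: (measurableT_comp measurable_giry_prod).
by apply: measurable_fun_pair; exact: measurable_kernel_prob.
Qed.

(** The law S. Written as a Giry bind of product measures, it is a probability by construction and
    its integrals reduce to iterated ones. *)
Definition sibling_law : giry (T * T)%type R := giry_bind mu measurable_sibling.

Lemma measurable_integral_sibling (f : T * T -> \bar R) :
  measurable_fun [set: T * T] f -> (forall z, 0 <= f z) ->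
  measurable_fun [set: T] (fun y => \int[k y]_x \int[k y]_x' f (x, x')).
Proof.
move=> mf f0; rewrite [X in measurable_fun _ X](_ : _ =
    (giry_int ^~ f) \o sibling); last first.
  by apply/funext => y /=; rewrite giry_int_prod1.
apply: measurableT_comp measurable_sibling; exact: measurable_giry_int.
Qed.

Lemma integral_sibling_law (f : T * T -> \bar R) :
  measurable_fun [set: T * T] f -> (forall z, 0 <= f z) ->
  \int[sibling_law]_z f z = \int[mu]_y \int[k y]_x \int[k y]_x' f (x, x').
Proof.
move=> mf f0; rewrite [LHS]giry_int_bind//.
by apply: eq_integral => y _; exact: giry_int_prod1.
Qed.

Lemma sibling_lawX A B : measurable A -> measurable B ->
  sibling_law (A `*` B) = \int[mu]_y (k y A * k y B).
Proof.
move=> mA mB; rewrite /sibling_law /giry_bind/= giry_int_map//.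
  by apply: eq_integral => y _/=; rewrite /giry_ev/= product_measure1E.
by apply: measurable_giry_ev; exact: measurableX.
Qed.

End joint_law_integration.

(** * The layer-cake formula *)

Section layer_cake.
Context (R : realType).

Lemma measurable_layer d' (X : measurableType d') (G H : X -> R) :
  measurable_fun [set: X] G -> measurable_fun [set: X] H ->
  measurable [set z : X * measurableTypeR R | H z.1 <= z.2 < G z.1]%R.
Proof.
move=> mG mH.
pose fl (z : X * measurableTypeR R) := (H z.1 <= z.2)%R.
pose fu (z : X * measurableTypeR R) := (z.2 < G z.1)%R.
rewrite [X in measurable X](_ : _ =
    fl @^-1` [set true] `&` fu @^-1` [set true]); last first.
  by apply/seteqP; split => z /= => [/andP|] [] // *; apply/andP.
have mfl : measurable_fun setT fl.
  by apply: measurable_fun_ler => //; exact: measurableT_comp.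
have mfu : measurable_fun setT fu.
  by apply: measurable_fun_ltr => //; exact: measurableT_comp.
by apply: measurableI; rewrite -[X in measurable X]setTI; [exact: mfl|exact: mfu].
Qed.

Lemma measurable_fun_layer d' (X : measurableType d') (P : giry X R)
    (G H : X -> R) :
  measurable_fun [set: X] G -> measurable_fun [set: X] H ->
  measurable_fun [set: measurableTypeR R]
    (fun t : measurableTypeR R => P [set x | H x <= t < G x]%R).
Proof.
move=> mG mH.
rewrite [X in measurable_fun _ X](_ : _ = P \o
    ysection [set z : X * measurableTypeR R | H z.1 <= z.2 < G z.1]%R).
  by apply: measurable_fun_ysection; exact: measurable_layer.
by apply/funext => t /=; congr (P _); rewrite ysectionE.
Qed.

(** Tonelli for the indicator of the region between the graphs of [H] and [G]: its slice over [x] is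
    the interval from [H x] to [G x], whose length is the positive part of the difference, and its
    slice at height [t] is the set on the right. *)
Lemma integral_layer_cake d' (X : measurableType d') (P : giry X R)
    (G H : X -> R) :
  measurable_fun [set: X] G -> measurable_fun [set: X] H ->
  \int[P]_x (Num.max (G x - H x) 0)%:E =
  \int[lebesgue_measure]_t P [set x | H x <= t < G x]%R.
Proof.
move=> mG mH.
pose C := [set z : X * measurableTypeR R | H z.1 <= z.2 < G z.1]%R.
have mC : measurable C by exact: measurable_layer.
have mIC : measurable_fun setT (fun z : X * measurableTypeR R => (\1_C z)%:E : \bar R).
  exact/measurable_EFinP/measurable_indic.
have := fubini_tonelli (fun z : X * measurableTypeR R => (\1_C z)%:E)
  (m1 := P) (m2 := lebesgue_measure) mIC.
move=> /(_ (fun z => _)) FT.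
transitivity (\int[P]_x \int[lebesgue_measure]_(t in [set: measurableTypeR R])
    (\1_C (x, t))%:E).
  apply: eq_integral => x _.
  rewrite (_ : (fun t => (\1_C (x, t))%:E) =
    (fun t : measurableTypeR R => (\1_(`[H x, G x[%classic : set R) t)%:E)).
    rewrite integral_indic//= setIT lebesgue_measure_itv/= lte_fin.
    case: ltP => hg; last by rewrite maxEle subr_le0 hg.
    by rewrite maxEle subr_le0 leNgt hg.
  apply/funext => t; rewrite !indicE; congr ((nat_of_bool _)%:R)%:E.
rewrite FT; last by move=> z; rewrite lee_fin.
apply: eq_integral => t _.
rewrite (_ : (fun x => (\1_C (x, t))%:E) =
    (fun x => (\1_[set x | H x <= t < G x]%R x)%:E)).
  rewrite integral_indic ?setIT//.
  have := measurable_ysection t mC.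
  by rewrite ysectionE.
by apply/funext => x; congr (_%:E); rewrite !indicE.
Qed.

End layer_cake.

(** * Existence of a median *)

Section median.
Context d (T : measurableType d) (R : realType) (mu : probability T R).

(** The median is the infimum of the levels at which the distribution function reaches 1/2. Right
    continuity of that function controls the mass above it, and continuity of [mu] along an
    increasing union controls the mass strictly below it. *)
Lemma median_exists (f : {RV mu >-> R}) : exists b : R,
  mu [set x | b < f x]%R <= 2^-1%:E /\ mu [set x | f x < b]%R <= 2^-1%:E.
Proof.
have [r1 hr1] : exists r, 2^-1%:E <= cdf f r.
  apply: contrapT => /forallNP h.
  have : (1 : \bar R) <= 2^-1%:E.
    apply: cvge_to_le (cvg_cdfy1 f) _; apply: nearW => r.
    by rewrite ltW// ltNge; exact/negP/h.
  by rewrite lee_fin; lra.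
have [r0 hr0] : exists r, cdf f r < 2^-1%:E.
  apply: contrapT => /forallNP h.
  have : (2^-1%:E : \bar R) <= 0.
    apply: cvge_to_ge (cvg_cdfNy0 f) _; apply: nearW => r.
    by rewrite leNgt; exact/negP/h.
  by rewrite lee_fin; lra.
pose E : set R := [set r | 2^-1%:E <= cdf f r].
have E0 : has_inf E.
  split; first by exists r1.
  exists r0 => r /= Er; rewrite leNgt; apply/negP => rr0.
  have /le_lt_trans/(_ hr0) := le_trans Er (cdf_nondecreasing f (ltW rr0)).
  by rewrite ltxx.
exists (inf E); split.
  have cb : 2^-1%:E <= cdf f (inf E).
    apply: cvge_to_ge (@cdf_right_continuous _ _ _ _ f (inf E)) _.
    near=> r; have [|e Ee er] := @inf_adherent _ E (r - inf E) _ E0.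
      by rewrite subr_gt0; near: r; exact: nbhs_right_gt.
    apply: le_trans Ee (cdf_nondecreasing f _).
    by move: er; rewrite addrC subrK => /ltW.
  have -> : [set x | inf E < f x]%R = ~` (f @^-1` `]-oo, inf E]%classic).
    by apply/seteqP; split => x /=; rewrite in_itv/= ltNge => /negP.
  rewrite probability_setC; last exact: measurable_funPTI.
  rewrite leeBlDr ?fin_num_measure//; last exact: measurable_funPTI.
  apply: le_trans (leeD2l _ cb); rewrite -EFinD lee_fin; lra.
(* [F n] cuts at a level strictly below the infimum, where the distribution function is still under
   1/2. *)
pose F n := f @^-1` `]-oo, (inf E - n.+1%:R^-1)%R]%classic.
have -> : [set x | f x < inf E]%R = \bigcup_n F n.
  apply/seteqP; split => [x /= fx|x [n _]].
    have /ltr_add_invr[n hn] : (f x < inf E)%R by [].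
    by exists n => //; rewrite /F/= in_itv/= lerBrDr ltW.
  rewrite /F/= in_itv/= => /le_lt_trans; apply.
  by rewrite ltrBlDr ltrDl invr_gt0.
apply: (@cvge_to_le _ _ _ _ _ _ _ (@nondecreasing_cvg_mu _ _ _ mu F _ _ _)).
- by move=> n; exact: measurable_funPTI.
- by apply: bigcup_measurable => n _; exact: measurable_funPTI.
- move=> n m nm; apply/subsetPset => x; rewrite /F/= !in_itv/= => /le_trans; apply.
  by rewrite lerD2l lerN2 lef_pV2 ?posrE// ler_nat.
apply: nearW => n /=; rewrite ltW// ltNge; apply/negP => h.
have : (inf E <= inf E - n.+1%:R^-1)%R by apply: ge_inf => //; exact: E0.2.
by rewrite leNgt ltrBlDr ltrDl invr_gt0 ltr0n.
Unshelve. all: by end_near. Qed.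

End median.

Lemma integral_cst_probability d (T : measurableType d) (R : realType)
    (mu : probability T R) (r : \bar R) : \int[mu]_x r = r.
Proof.
rewrite integral_cst// -[RHS]mule1; congr (_ * _); exact: probability_setT.
Qed.

Lemma measurable_superlevel d (T : measurableType d) (R : realType)
    (F : T -> R) t :
  measurable_fun [set: T] F -> measurable [set x | t < F x]%R.
Proof.
move=> mF.
have mEF : measurable_fun [set: T] (EFin \o F) by exact/measurable_EFinP.
have := measurable_lte measurableT (measurable_cst t%:E) mEF.
by rewrite setTI.
Qed.

(** * Second moments and variance *)

Section square_integrable.
Context d (T : measurableType d) (R : realType) (nu : probability T R).

Lemma measurable_sqr (f : T -> R) : measurable_fun [set: T] f ->
  measurable_fun [set: T] (fun x => (f x ^+ 2)%:E).
Proof. by move=> mf; apply/measurable_EFinP; exact: measurable_funX. Qed.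

Lemma integrable_sqr (f : T -> R) : measurable_fun [set: T] f ->
  \int[nu]_x (f x ^+ 2)%:E < +oo -> nu.-integrable setT (fun x => (f x ^+ 2)%:E).
Proof.
move=> mf fy; apply/integrableP; split; first exact: measurable_sqr.
by under eq_integral do rewrite gee0_abs ?lee_fin ?sqr_ge0//.
Qed.

Lemma integrable_of_sqr (f : T -> R) : measurable_fun [set: T] f ->
  \int[nu]_x (f x ^+ 2)%:E < +oo -> nu.-integrable setT (EFin \o f).
Proof.
move=> mf fy.
apply: (@le_integrable _ _ _ _ _ _ _ (fun x => 1 + (f x ^+ 2)%:E)) => //.
- exact/measurable_EFinP.
- move=> x _; rewrite -EFinD /= lee_fin (ger0_norm (x := (_ + _)%R)).
    have := sqr_ge0 (`|f x| - 1)%R; rewrite -(real_normK (num_real (f x))); nra.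
  by rewrite addr_ge0// sqr_ge0.
- apply: integrableD => //; first exact: finite_measure_integrable_cst.
  exact: integrable_sqr.
Qed.

Lemma integral_sqr_shift (f : T -> R) (b : R) : measurable_fun [set: T] f ->
  \int[nu]_x (f x ^+ 2)%:E < +oo ->
  \int[nu]_x ((f x - b) ^+ 2)%:E =
    \int[nu]_x (f x ^+ 2)%:E - (2 * b * (\int[nu]_x f x)%R)%:E + (b ^+ 2)%:E.
Proof.
move=> mf fy; have if2 := integrable_sqr mf fy; have if1 := integrable_of_sqr mf fy.
transitivity (\int[nu]_x
    (((f x ^+ 2)%:E + (- (2 * b))%:E * (f x)%:E) + (b ^+ 2)%:E)).
  by apply: eq_integral => x _; rewrite -EFinM -!EFinD; congr _%:E; ring.
have i2 : nu.-integrable setT (fun x => (- (2 * b))%:E * (f x)%:E).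
  exact: integrableZl.
rewrite integralD//; last 2 first.
- exact: integrableD.
- exact: finite_measure_integrable_cst.
rewrite integralD// integralZl// integral_cst_probability.
rewrite /Rintegral [in RHS]EFinM fineK; first by rewrite EFinN mulNe.
exact: integrable_fin_num.
Qed.

(** With a finite second moment both sides agree: the squared distance of two independent draws has
    mean twice the variance. With an infinite one the right side is [+oo], whatever default value
    the mean takes. *)
Lemma sqr_mean_add_pair_variance_le (f : T -> R) : measurable_fun [set: T] f ->
  (2 * (\int[nu]_x f x) ^+ 2)%R%:E +
  \int[nu]_x \int[nu]_x' ((f x - f x') ^+ 2)%:E <=
  2%:E * \int[nu]_x (f x ^+ 2)%:E.
Proof.
move=> mf; have [->|] := eqVneq (\int[nu]_x (f x ^+ 2)%:E) +oo.
  by rewrite gt0_muley ?lte_fin ?leey.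
rewrite -ltey => fy; set m := (\int[nu]_x f x)%R.
have AE : \int[nu]_x (f x ^+ 2)%:E = (fine (\int[nu]_x (f x ^+ 2)%:E))%:E.
  rewrite fineK// ge0_fin_numE//.
  by apply: integral_ge0 => x _; rewrite lee_fin sqr_ge0.
set A := fine _ in AE.
(* This is the variance; its sign lets the sum below be integrated term by term. *)
have Am : (0 <= A - m ^+ 2)%R.
  have : 0 <= \int[nu]_x ((f x - m) ^+ 2)%:E.
    by apply: integral_ge0 => x _; rewrite lee_fin sqr_ge0.
  rewrite integral_sqr_shift// AE -/m -EFinB -EFinD lee_fin; nra.
(* The inner integral is the second moment about [f x], expanded by [integral_sqr_shift] and
   regrouped around [m]. *)
have -> : \int[nu]_x \int[nu]_x' ((f x - f x') ^+ 2)%:E =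
    \int[nu]_x (((f x - m) ^+ 2)%:E + (A - m ^+ 2)%:E).
  apply: eq_integral => x _.
  under eq_integral do rewrite -sqrrN opprB.
  by rewrite integral_sqr_shift// AE -/m -EFinB -!EFinD; congr _%:E; ring.
rewrite ge0_integralD//; last 2 first.
- by move=> x _; rewrite lee_fin sqr_ge0.
- by apply: measurable_sqr; exact: measurable_funB.
rewrite integral_sqr_shift// integral_cst_probability AE -/m.
rewrite -EFinB -!EFinD -EFinM lee_fin le_eqVlt; apply/orP; left; apply/eqP; ring.
Qed.

End square_integrable.

(** * Cheeger's inequality for a law [S] with both marginals [mu] *)

Section cheeger.
Context d (T : measurableType d) (R : realType).
Variables (mu : probability T R) (S : giry (T * T)%type R) (c : R).
Hypothesis c_gt0 : (0 < c)%R.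
Hypothesis S_fst : forall F : T -> \bar R, measurable_fun [set: T] F ->
  (forall x, 0 <= F x) -> \int[S]_z F z.1 = \int[mu]_x F x.
Hypothesis S_snd : forall F : T -> \bar R, measurable_fun [set: T] F ->
  (forall x, 0 <= F x) -> \int[S]_z F z.2 = \int[mu]_x F x.
Hypothesis S_cut : forall A, measurable A ->
  c%:E * (mu A * mu (~` A)) <= S (A `*` ~` A).

(** Layer cake for [F ^+ 2] on both sides: at height [t] the slice on the right is [A] times its
    complement, with [A] the superlevel set. As [A] lies where [F] is positive, its complement has
    mass at least 1/2, whence the factor 1/2 after [S_cut]. *)
Lemma coarea_lower_bound (F : T -> R) : measurable_fun [set: T] F ->
  (forall x, 0 <= F x)%R -> mu [set x | 0 < F x]%R <= 2^-1%:E ->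
  (c / 2)%:E * \int[mu]_x (F x ^+ 2)%:E <=
  \int[S]_z (Num.max (F z.1 ^+ 2 - F z.2 ^+ 2) 0)%:E.
Proof.
move=> mF F0 F_half.
have mF2 : measurable_fun [set: T] (fun x => F x ^+ 2)%R by exact: measurable_funX.
have mG : measurable_fun [set: T * T] (fun z => F z.1 ^+ 2)%R.
  by apply: (measurableT_comp mF2).
have mH : measurable_fun [set: T * T] (fun z => F z.2 ^+ 2)%R.
  by apply: (measurableT_comp mF2).
have mS := measurable_fun_layer S mG mH.
have mmu := measurable_fun_layer mu mF2 (measurable_cst (0%R : R)).
rewrite (integral_layer_cake S mG mH).
rewrite (_ : \int[mu]_x _ =
    \int[lebesgue_measure]_t mu [set x | 0 <= t < F x ^+ 2]%R); last first.
  rewrite -(integral_layer_cake mu mF2 (measurable_cst (0%R : R))).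
  apply: eq_integral => x _; rewrite subr0; congr _%:E.
  by apply/esym/max_idPl; exact: sqr_ge0.
have c20 : (0 <= c / 2)%R by rewrite divr_ge0// ltW.
rewrite -ge0_integralZl//.
apply: ge0_le_integral => //.
- by move=> t _; rewrite mule_ge0// lee_fin.
- exact: measurable_funeM.
(* Below zero the slice on the left is empty, since it carries the condition [0 <= t]. *)
move=> t _; have [t0|t0] := ltP t 0%R.
  rewrite (_ : [set x | _] = set0) ?measure0 ?mule0//.
  by apply/seteqP; split => x //= /andP[/(lt_le_trans t0)]; rewrite ltxx.
pose A : set T := [set x | t < F x ^+ 2]%R.
have mA : measurable A.
  exact: measurable_superlevel.
rewrite (_ : [set x | _] = A); last by apply/seteqP; split => x //=; rewrite t0.
rewrite (_ : [set x | _] = A `*` ~` A); last first.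
  apply/seteqP; split => -[x x'] /=; rewrite /A/=.
    by move=> /andP[le lt]; split => //; apply/negP; rewrite -leNgt.
  by move=> [-> /negP]; rewrite -leNgt => ->.
apply: le_trans (S_cut mA).
rewrite EFinM -muleA; apply: lee_wpmul2l; first by rewrite lee_fin ltW.
rewrite muleC; apply: lee_wpmul2l => //.
rewrite probability_setC// leeBrDr ?fin_num_measure//.
apply: (@le_trans _ _ (2^-1%:E + 2^-1%:E)); last by rewrite -EFinD lee_fin; lra.
apply: leeD2l; apply: le_trans F_half; apply: le_measure; rewrite ?inE//.
  exact: measurable_superlevel.
move=> x; rewrite /A/= => tF; rewrite lt_neqAle F0 andbT eq_sym.
by apply/eqP => Fx0; move: tF; rewrite Fx0 expr0n/= ltNge t0.
Qed.

(** The coarea bound, AM-GM and the two marginals give c/2 N <= 4/c D + c/4 N, where N is the second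
    moment and D the integral on the right. Since N is finite the last term is absorbed, and
    multiplying by c/4 leaves c^2/16. *)
Lemma cheeger_nonneg (F : T -> R) : measurable_fun [set: T] F ->
  (forall x, 0 <= F x)%R -> mu [set x | 0 < F x]%R <= 2^-1%:E ->
  \int[mu]_x (F x ^+ 2)%:E < +oo ->
  (c ^+ 2 / 16)%:E * \int[mu]_x (F x ^+ 2)%:E <=
  \int[S]_z ((F z.1 - F z.2) ^+ 2)%:E.
Proof.
move=> mF F0 F_half Ny.
have mF2 : measurable_fun [set: T] (fun x => (F x ^+ 2)%:E).
  by apply/measurable_EFinP; exact: measurable_funX.
have mD : measurable_fun [set: T * T] (fun z => ((F z.1 - F z.2) ^+ 2)%:E).
  apply/measurable_EFinP/measurable_funX/measurable_funB.
    exact: (measurableT_comp mF).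
  exact: (measurableT_comp mF).
have mG : measurable_fun [set: T * T] (fun z => (F z.1 ^+ 2)%:E).
  exact: (measurableT_comp mF2).
have mH : measurable_fun [set: T * T] (fun z => (F z.2 ^+ 2)%:E).
  exact: (measurableT_comp mF2).
have F2ge0 x : 0 <= (F x ^+ 2)%:E by rewrite lee_fin sqr_ge0.
(* AM-GM: [a^2 - b^2 <= 4 (a - b)^2 / c + c (a^2 + b^2) / 8] *)
have le4 : (c / 2)%:E * \int[mu]_x (F x ^+ 2)%:E <=
    (4 / c)%:E * \int[S]_z ((F z.1 - F z.2) ^+ 2)%:E +
    (c / 8)%:E * (\int[mu]_x (F x ^+ 2)%:E + \int[mu]_x (F x ^+ 2)%:E).
  apply: le_trans (coarea_lower_bound mF F0 F_half) _.
  rewrite -{1}(S_fst mF2)// -(S_snd mF2)//.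
  have c4 : 0 <= (4 / c)%:E by rewrite lee_fin divr_ge0// ltW.
  have c8 : 0 <= (c / 8)%:E by rewrite lee_fin divr_ge0// ltW.
  rewrite -ge0_integralD// -!ge0_integralZl//.
  all: try by [move=> *; rewrite ?adde_ge0 ?lee_fin ?sqr_ge0|exact: emeasurable_funD].
  rewrite -ge0_integralD//.
  all: try by [move=> *; rewrite mule_ge0// ?adde_ge0// lee_fin sqr_ge0
              |by do ?[apply: measurable_funeM|apply: emeasurable_funD]].
  apply: ge0_le_integral => //.
  - by move=> z _; rewrite lee_fin le_max lexx orbT.
  - apply/measurable_EFinP/measurable_maxr => //.
    by apply: measurable_funB; apply/measurable_EFinP.
  - by do ?[apply: measurable_funeM|apply: emeasurable_funD].
  move=> z _; rewrite -[X in _ + _ * X]EFinD -!EFinM -EFinD lee_fin.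
  have c0 : c != 0%R by rewrite gt_eqF.
  set a := F z.1; set b := F z.2.
  rewrite ge_max; apply/andP; split; last first.
    by rewrite addr_ge0// mulr_ge0 ?addr_ge0 ?sqr_ge0// divr_ge0// ltW.
  rewrite -subr_ge0 (_ : _ - _ = ((8 * (a - b) - c * (a + b)) ^+ 2 +
     (c * (a - b)) ^+ 2) / (16 * c))%R; last by field.
  by rewrite divr_ge0 ?addr_ge0 ?sqr_ge0// mulr_ge0// ltW.
have [n nE] : exists n, \int[mu]_x (F x ^+ 2)%:E = n%:E.
  exists (fine (\int[mu]_x (F x ^+ 2)%:E)); rewrite fineK// ge0_fin_numE//.
  exact: integral_ge0.
have : 0 <= \int[S]_z ((F z.1 - F z.2) ^+ 2)%:E.
  by apply: integral_ge0 => z _; rewrite lee_fin sqr_ge0.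
move: le4; rewrite nE; case: (\int[S]_z _) => [D| |]; last 2 first.
- by move=> _ _; rewrite leey.
- by [].
rewrite -[X in _ + _ * X]EFinD -!EFinM -EFinD !lee_fin => le4 _.
have c0 : c != 0%R by rewrite gt_eqF.
rewrite -subr_ge0 (_ : _ - _ =
  (4 / c * D + c / 8 * (n + n) - c / 2 * n) * (c / 4))%R; last by field.
by rewrite mulr_ge0 ?subr_ge0// divr_ge0// ltW.
Qed.

(** Subtracting a median [b] makes the positive part [Fp] and the negative part [Fm] of [f - b] live
    on sets of mass at most 1/2, so that the nonnegative case applies to each. *)
Lemma cheeger_median (f : {RV mu >-> R}) : \int[mu]_x (f x ^+ 2)%:E < +oo ->
  exists b : R, (c ^+ 2 / 16)%:E * \int[mu]_x ((f x - b) ^+ 2)%:E <=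
    \int[S]_z ((f z.1 - f z.2) ^+ 2)%:E.
Proof.
move=> fy; have [b [bgt blt]] := median_exists f; exists b.
pose g x := (f x - b)%R.
have mf : measurable_fun [set: T] f by [].
have mg : measurable_fun [set: T] g by exact: measurable_funB.
pose Fp x := Num.max (g x) 0%R; pose Fm x := Num.max (- g x)%R 0%R.
have mFp : measurable_fun [set: T] Fp by exact: measurable_maxr.
have mFm : measurable_fun [set: T] Fm.
  by apply: measurable_maxr => //; exact: measurable_funN.
have Fp0 x : (0 <= Fp x)%R by rewrite le_max lexx orbT.
have Fm0 x : (0 <= Fm x)%R by rewrite le_max lexx orbT.
have Fp_half : mu [set x | 0 < Fp x]%R <= 2^-1%:E.
  rewrite (_ : [set x | _] = [set x | b < f x]%R)//.
  by apply/seteqP; split => x /=; rewrite lt_max ltxx orbF subr_gt0.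
have Fm_half : mu [set x | 0 < Fm x]%R <= 2^-1%:E.
  rewrite (_ : [set x | _] = [set x | f x < b]%R)//.
  by apply/seteqP; split => x /=; rewrite lt_max ltxx orbF opprB subr_gt0.
have gE x : (g x ^+ 2 = Fp x ^+ 2 + Fm x ^+ 2)%R.
  by rewrite /Fp /Fm !maxEle; case: (leP (g x) 0%R); case: (leP (- g x)%R 0%R); nra.
have msq (F : T -> R) : measurable_fun [set: T] F ->
    measurable_fun [set: T] (fun x => (F x ^+ 2)%:E).
  by move=> mF; apply/measurable_EFinP; exact: measurable_funX.
have sq0 (r : R) : 0 <= (r ^+ 2)%:E by rewrite lee_fin sqr_ge0.
have gy : \int[mu]_x (g x ^+ 2)%:E < +oo.
  (* Domination by (f - b)^2 <= 2 f^2 + 2 b^2, the difference being (f + b)^2. *)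
  have : \int[mu]_x (2%:E * (f x ^+ 2)%:E + (2 * b ^+ 2)%:E) < +oo.
    have m2f : measurable_fun [set: T] (fun x => 2%:E * (f x ^+ 2)%:E).
      by apply: measurable_funeM; exact: msq.
    have b20 : 0 <= (2 * b ^+ 2)%:E by rewrite lee_fin mulr_ge0// sqr_ge0.
    rewrite ge0_integralD//; last by move=> x _; rewrite mule_ge0.
    rewrite ge0_integralZl//; last exact: msq.
    rewrite integral_cst_probability lte_add_pinfty// ?ltry//.
    by rewrite lte_mul_pinfty.
  apply: le_lt_trans; apply: ge0_le_integral => //; first exact: msq.
    apply: emeasurable_funD; last exact: measurable_cst.
    by apply: measurable_funeM; exact: msq.
  move=> x _; rewrite -EFinM -EFinD lee_fin /g -subr_ge0.
  by rewrite (_ : _ - _ = (f x + b) ^+ 2)%R ?sqr_ge0//; ring.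
have Fpy : \int[mu]_x (Fp x ^+ 2)%:E < +oo.
  apply: le_lt_trans gy; apply: ge0_le_integral => //; [exact: msq..|].
  by move=> x _; rewrite lee_fin gE lerDl sqr_ge0.
have Fmy : \int[mu]_x (Fm x ^+ 2)%:E < +oo.
  apply: le_lt_trans gy; apply: ge0_le_integral => //; [exact: msq..|].
  by move=> x _; rewrite lee_fin gE lerDr sqr_ge0.
have mdiff (F : T -> R) : measurable_fun [set: T] F ->
    measurable_fun [set: T * T] (fun z => ((F z.1 - F z.2) ^+ 2)%:E).
  move=> mF; apply/measurable_EFinP/measurable_funX/measurable_funB.
    exact: (measurableT_comp mF).
  exact: (measurableT_comp mF).
under eq_integral do rewrite -/(g _) gE EFinD.
rewrite ge0_integralD//; [|exact: msq..].
rewrite ge0_muleDr ?integral_ge0//.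
apply: (le_trans (leeD (cheeger_nonneg mFp Fp0 Fp_half Fpy)
                       (cheeger_nonneg mFm Fm0 Fm_half Fmy))).
rewrite -ge0_integralD//; [|exact: mdiff..].
apply: ge0_le_integral => //.
- by move=> z _; rewrite adde_ge0.
- by apply: emeasurable_funD; exact: mdiff.
- exact: mdiff.
move=> z _; rewrite -EFinD lee_fin.
rewrite (_ : f z.1 - f z.2 = g z.1 - g z.2)%R; last by rewrite /g; ring.
(* The increments of [Fp] and [Fm] have a product at most 0, so the cross term of (g z.1 - g z.2)^2
   can only add to the sum of their squares. *)
rewrite /Fp /Fm !maxEle.
by case: (leP (g z.1) 0%R); case: (leP (- g z.1)%R 0%R);
   case: (leP (g z.2) 0%R); case: (leP (- g z.2)%R 0%R); nra.
Qed.

(** For centred [f] the shift adds exactly b^2, so the mean may replace the median in the previous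
    bound. *)
Lemma integral_sqr_le_shift (f : {RV mu >-> R}) b :
  \int[mu]_x (f x ^+ 2)%:E < +oo -> \int[mu]_x (f x)%:E = 0 ->
  \int[mu]_x (f x ^+ 2)%:E <= \int[mu]_x ((f x - b) ^+ 2)%:E.
Proof.
move=> fy f0; rewrite integral_sqr_shift// /Rintegral f0 mulr0 sube0.
by rewrite leeDl// lee_fin sqr_ge0.
Qed.

Lemma cheeger_inequality (f : {RV mu >-> R}) :
  \int[mu]_x (f x ^+ 2)%:E < +oo -> \int[mu]_x (f x)%:E = 0 ->
  (c ^+ 2 / 16)%:E * \int[mu]_x (f x ^+ 2)%:E <=
  \int[S]_z ((f z.1 - f z.2) ^+ 2)%:E.
Proof.
move=> fy f0; have [b] := cheeger_median fy; apply: le_trans.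
apply: lee_wpmul2l; last exact: integral_sqr_le_shift.
by rewrite lee_fin divr_ge0// sqr_ge0.
Qed.

End cheeger.

(** * Kernels acting on signed functions *)

Section signed_bind.
Context d1 d2 (X : measurableType d1) (Y : measurableType d2) (R : realType).
Variable k : R.-pker X ~> Y.

Lemma measurable_Rintegral_kernel (f : Y -> R) : measurable_fun [set: Y] f ->
  measurable_fun [set: X] (fun x => \int[k x]_y f y)%R.
Proof.
move=> mf; have mEf : measurable_fun [set: Y] (EFin \o f) by exact/measurable_EFinP.
apply: (measurableT_comp (fine_measurable _)) => //.
rewrite [X in measurable_fun _ X](_ : _ = (fun x =>
    \int[k x]_y (EFin \o f)^\+ y - \int[k x]_y (EFin \o f)^\- y)); last first.
  by apply/funext => x; rewrite integralE.
apply: emeasurable_funB; apply: measurable_integral_kernel => //.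
  exact: measurable_funepos.
exact: measurable_funeneg.
Qed.

Variables (m : probability X R) (nu : {measure set Y -> \bar R}).
Hypothesis nuE : forall A, measurable A -> nu A = \int[m]_x k x A.

(** Positive and negative parts integrate separately. Both inner integrals are finite for [m]-almost
    every [x], and default values of [Rintegral] are confined to the remaining null set. *)
Lemma Rintegral_bind (f : Y -> R) : nu.-integrable setT (EFin \o f) ->
  \int[m]_x (\int[k x]_y f y)%R%:E = \int[nu]_y (f y)%:E.
Proof.
move=> intf; have /integrableP[mEf fy] := intf.
have mf : measurable_fun [set: Y] f by exact/measurable_EFinP.
have mfp : measurable_fun [set: Y] (EFin \o f)^\+ by exact: measurable_funepos.
have mfn : measurable_fun [set: Y] (EFin \o f)^\- by exact: measurable_funeneg.
have ip : m.-integrable setT (fun x => \int[k x]_y (EFin \o f)^\+ y).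
  apply/integrableP; split; first exact: measurable_integral_kernel.
  under eq_integral do rewrite gee0_abs ?integral_ge0//.
  by rewrite -(integral_kernel_bind nuE)//; exact: integral_funepos_lt_pinfty.
have in_ : m.-integrable setT (fun x => \int[k x]_y (EFin \o f)^\- y).
  apply/integrableP; split; first exact: measurable_integral_kernel.
  under eq_integral do rewrite gee0_abs ?integral_ge0//.
  by rewrite -(integral_kernel_bind nuE)//; exact: integral_funeneg_lt_pinfty.
rewrite [RHS]integralE !(integral_kernel_bind nuE)// -integralB//.
apply: ae_eq_integral => //.
- by apply/measurable_EFinP; exact: measurable_Rintegral_kernel.
- by apply: emeasurable_funB; exact: measurable_integral_kernel.
have := integrable_ae measurableT ip; have := integrable_ae measurableT in_.
apply: filterS2 => x /= fn_fin fp_fin _.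
by rewrite /Rintegral integralE fineK// fin_numB fp_fin// fn_fin.
Qed.

End signed_bind.

(** * Iterated kernels and powers of the Markov operator *)

Section nstep_theory.
Context d (T : measurableType d) (R : realType).
Variables (p : R.-pker T ~> T) (mu : probability T R).

Lemma nstepS m x A : nstep p m.+1 x A = \int[p x]_y nstep p m y A.
Proof. by []. Qed.

Lemma integral_nstep0 x (f : T -> \bar R) : measurable_fun [set: T] f ->
  \int[nstep p 0 x]_y f y = f x.
Proof. by move=> mf; rewrite /= integral_dirac// diracT mul1e. Qed.

Lemma integral_nstepS m x (f : T -> \bar R) : measurable_fun [set: T] f ->
  (forall y, 0 <= f y) ->
  \int[nstep p m.+1 x]_y f y = \int[p x]_y \int[nstep p m y]_z f z.
Proof.
by move=> mf f0; apply: (integral_kernel_bind (m := kernel_prob p x)).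
Qed.

(** Chapman-Kolmogorov. Since [nstep] splits off the first step, the induction on [m] keeps the
    starting point general. *)
Lemma nstepD m n x A : measurable A ->
  nstep p (m + n) x A = \int[nstep p m x]_y nstep p n y A.
Proof.
move=> mA; have mn k : measurable_fun [set: T] (fun y => nstep p k y A).
  exact: measurable_kernel.
elim: m x => [|m IH] x; first by rewrite add0n integral_nstep0.
rewrite addSn nstepS integral_nstepS//.
by apply: eq_integral => y _; exact: IH.
Qed.

Hypothesis mu_inv : invariant_measure p mu.

Lemma integral_invariant (k : R.-pker T ~> T) (f : T -> \bar R) :
  invariant_measure k mu -> measurable_fun [set: T] f ->
  (forall y, 0 <= f y) -> \int[mu]_x \int[k x]_y f y = \int[mu]_x f x.
Proof.
by move=> kmu mf f0; rewrite -(integral_kernel_bind (nu := mu))// => A /kmu.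
Qed.

Lemma nstep_invariant m : invariant_measure (nstep p m) mu.
Proof.
elim: m => [|m IH] A mA.
  transitivity (\int[mu]_x (\1_A x)%:E); last by rewrite integral_indic ?setIT.
  by apply: eq_integral => x _; rewrite /= /kdirac diracE indicE.
under eq_integral do rewrite nstepS.
by rewrite integral_invariant ?IH//; exact: measurable_kernel.
Qed.

Lemma null_set_invariant (k : R.-pker T ~> T) N : invariant_measure k mu ->
  measurable N -> mu N = 0 -> \forall x \ae mu, k x N = 0.
Proof.
move=> kmu mN N0.
have mkN : measurable_fun [set: T] (fun x => k x N) by exact: measurable_kernel.
have /(ae_eq_integral_abs mu measurableT mkN) : \int[mu]_x `|k x N| = 0.
  by under eq_integral do rewrite gee0_abs//; rewrite kmu.
by apply: filterS => x /(_ I).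
Qed.

(** By invariance a [mu]-null set is also null for [k x], for almost every [x]; the operator thus
    acts on classes modulo null sets. *)
Lemma markov_op_ae (k : R.-pker T ~> T) (f g : T -> R) :
  invariant_measure k mu -> measurable_fun [set: T] f ->
  measurable_fun [set: T] g -> (\forall x \ae mu, f x = g x) ->
  \forall x \ae mu, markov_op k f x = markov_op k g x.
Proof.
move=> kmu mf mg [N [mN N0 fgN]].
have := null_set_invariant kmu mN N0; apply: filterS => x kN0.
congr fine; apply: ae_eq_integral => //; [exact/measurable_EFinP..|].
by exists N; split => // y /= fgy; apply: fgN => /= fg; apply: fgy => _; rewrite fg.
Qed.

Lemma measurable_markov_op (k : R.-pker T ~> T) (f : T -> R) :
  measurable_fun [set: T] f -> measurable_fun [set: T] (markov_op k f).
Proof. by move=> mf; exact: measurable_Rintegral_kernel. Qed.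

Lemma measurable_iter_markov_op m (f : T -> R) : measurable_fun [set: T] f ->
  measurable_fun [set: T] (iter m (markov_op p) f).
Proof. by move=> mf; elim: m => //= m IH; exact: measurable_markov_op. Qed.

(** Only almost everywhere: where |f| is not integrable for the law after m + 1 steps, the iterated
    and the direct integral may take unrelated default values. Invariance makes that set null. *)
Lemma iter_markov_op_ae m (f : T -> R) : mu.-integrable setT (EFin \o f) ->
  \forall x \ae mu, iter m (markov_op p) f x = markov_op (nstep p m) f x.
Proof.
move=> /integrableP[mEf fy]; have mf : measurable_fun [set: T] f by exact/measurable_EFinP.
elim: m => [|m IH].
  apply: nearW => x /=; rewrite /markov_op /Rintegral.
  by rewrite (integral_nstep0 _ mEf).
have mI := measurable_iter_markov_op m mf.
have mM := measurable_markov_op (nstep p m) mf.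
have IH' := markov_op_ae mu_inv mI mM IH.
have mabs : measurable_fun [set: T] (abse \o (EFin \o f)) by exact: measurableT_comp.
have iabs : mu.-integrable setT (fun x => \int[nstep p m.+1 x]_y `|f y|%:E).
  apply/integrableP; split; first exact: measurable_integral_kernel.
  under eq_integral do rewrite gee0_abs ?integral_ge0//.
  by rewrite integral_invariant//; exact: nstep_invariant.
have := integrable_ae measurableT iabs; move: IH'.
apply: filterS2 => x /= -> /(_ I) fin_x.
congr fine; apply: (Rintegral_bind (m := kernel_prob p x)) => //.
by apply/integrableP; split => //; rewrite -ge0_fin_numE// integral_ge0.
Qed.

End nstep_theory.

(** * L^2 estimates for an invariant kernel *)

Section markov_L2.
Context d (T : measurableType d) (R : realType).
Variables (mu : probability T R) (k : R.-pker T ~> T).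
Hypothesis k_inv : invariant_measure k mu.

(* An inequality, because f need not be square integrable for k y at every y. *)
Lemma markov_op_dirichlet (f : T -> R) : measurable_fun [set: T] f ->
  2%:E * \int[mu]_x (markov_op k f x ^+ 2)%:E +
    \int[sibling_law mu k]_z ((f z.1 - f z.2) ^+ 2)%:E <=
  2%:E * \int[mu]_x (f x ^+ 2)%:E.
Proof.
move=> mf.
have mdiff : measurable_fun [set: T * T] (fun z => ((f z.1 - f z.2) ^+ 2)%:E).
  apply/measurable_EFinP/measurable_funX/measurable_funB.
    exact: (measurableT_comp mf).
  exact: (measurableT_comp mf).
have sq0 (r : R) : 0 <= (r ^+ 2)%:E by rewrite lee_fin sqr_ge0.
have mM := measurable_sqr (measurable_markov_op k mf).
have mV : measurable_fun [set: T]
    (fun y => \int[k y]_x \int[k y]_x' ((f x - f x') ^+ 2)%:E).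
  exact: (measurable_integral_sibling k mdiff).
have kf2 := integral_invariant k_inv (measurable_sqr mf) (fun x => sq0 _).
have mkf2 : measurable_fun [set: T] (fun y => \int[k y]_x (f x ^+ 2)%:E).
  by apply: measurable_integral_kernel => //; exact: measurable_sqr.
have kf20 y : 0 <= \int[k y]_x (f x ^+ 2)%:E by exact: integral_ge0.
rewrite -{}kf2 integral_sibling_law// -!ge0_integralZl//.
have in0 y : 0 <= \int[k y]_x \int[k y]_x' ((f x - f x') ^+ 2)%:E.
  by apply: integral_ge0 => x _; exact: integral_ge0.
rewrite -ge0_integralD//; [|by move=> *; rewrite mule_ge0|exact: measurable_funeM].
apply: ge0_le_integral => //.
- by move=> y _; rewrite adde_ge0// mule_ge0.
- by apply: emeasurable_funD => //; exact: measurable_funeM.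
- by apply: measurable_funeM; apply: measurable_integral_kernel => //; exact: measurable_sqr.
(* For fixed [y] this is the mean-variance inequality of [k y]; invariance has already turned the
   second moment under [mu] into an average over [y]. *)
move=> y _; rewrite -EFinM.
exact: (sqr_mean_add_pair_variance_le (kernel_prob k y)).
Qed.

(** The Dirichlet form on the left of [markov_op_dirichlet] is nonnegative and may be dropped. *)
Lemma markov_op_contraction (f : T -> R) : measurable_fun [set: T] f ->
  \int[mu]_x (markov_op k f x ^+ 2)%:E <= \int[mu]_x (f x ^+ 2)%:E.
Proof.
move=> mf; rewrite -(@lee_pmul2l _ 2%:E)//.
apply: le_trans (markov_op_dirichlet mf); rewrite leeDl//.
by apply: integral_ge0 => z _; rewrite lee_fin sqr_ge0.
Qed.

Lemma integral_markov_op (f : T -> R) : mu.-integrable setT (EFin \o f) ->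
  \int[mu]_x (markov_op k f x)%:E = \int[mu]_x (f x)%:E.
Proof. by move=> intf; apply: Rintegral_bind => // A /k_inv. Qed.

End markov_L2.

(* Outside the integrable case both sides are the junk value 0. *)
Lemma RintegralZl_measurable d (T : measurableType d) (R : realType)
    (nu : probability T R) (a : R) (f : T -> R) : measurable_fun [set: T] f ->
  (\int[nu]_x (a * f x) = a * \int[nu]_x f x)%R.
Proof.
move=> mf; have [fin_f|ninf] := pselect (nu.-integrable setT (EFin \o f)).
  exact: RintegralZl.
have [->|a0] := eqVneq a 0%R.
  by rewrite mul0r; under eq_Rintegral do rewrite mul0r; rewrite /Rintegral integral0.
have zero (g : T -> R) : measurable_fun [set: T] g ->
    ~ nu.-integrable setT (EFin \o g) -> (\int[nu]_x g x)%R = 0%R.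
  move=> mg; have mEg : measurable_fun [set: T] (EFin \o g) by exact/measurable_EFinP.
  move=> ng; rewrite /Rintegral; case I : (\int[nu]_x _) => [r| |]//; exfalso.
  apply: ng; apply/integrableP; split => //.
  by apply/(abse_integralP nu measurableT mEg); rewrite /= I ltry.
rewrite (zero _ mf ninf) mulr0 zero//; first exact: measurable_funM.
move=> iaf; apply: ninf.
have := integrableZl measurableT a^-1 iaf; apply: eq_integrable => // x _ /=.
by rewrite -EFinM mulrA mulVf// mul1r.
Qed.

(** The equality holds at every point, not only almost everywhere, since scaling also respects the
    default value of the integral. *)
Lemma iter_markov_opZ d (T : measurableType d) (R : realType)
    (p : R.-pker T ~> T) (m : nat) (a : R) (f : T -> R) :
  measurable_fun [set: T] f ->
  iter m (markov_op p) (fun x => a * f x)%R =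
  (fun x => a * iter m (markov_op p) f x)%R.
Proof.
move=> mf; elim: m => //= m ->; apply/funext => x.
apply: (RintegralZl_measurable (kernel_prob p x)).
exact: measurable_iter_markov_op.
Qed.

(** * Uniform integrability from an L^q bound *)

Section truncation.
Context d (T : measurableType d) (R : realType).

(** Above the level [K] one has r = r^q / r^(q - 1), and lowering the denominator to K^(q - 1) only
    increases the quotient. *)
Lemma le_add_powR (q K r : R) : (1 < q)%R -> (0 < K)%R -> (0 <= r)%R ->
  (r <= K + r `^ q / K `^ (q - 1))%R.
Proof.
move=> q1 K0 r0; have [rK|Kr] := leP r K.
  by rewrite (le_trans rK)// lerDl divr_ge0// powR_ge0.
rewrite (@le_trans _ _ (r `^ q / K `^ (q - 1))%R)//; last by rewrite lerDr ltW.
rewrite ler_pdivlMr ?powR_gt0// -[leRHS]mulr_powRB1//; last by rewrite (lt_trans _ q1).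
rewrite ler_wpM2l// ge0_ler_powR// ?nnegrE ?(ltW Kr)// ?subr_ge0 ltW//.
Qed.

(** [K] is fixed before [nu] and [u]: an L^q bound makes the whole family uniformly integrable. For
    finite q, |u| is at most K + |u|^q / K^(q - 1), and the last term integrates to at most
    [eps]. *)
Lemma integral_le_of_Lnorm (q : \bar R) (M eps : R) :
  1 < q -> (0 < M)%R -> (0 < eps)%R ->
  exists2 K : R, (0 < K)%R &
    forall (nu : probability T R) (u : T -> \bar R),
      measurable_fun [set: T] u -> (forall x, u x \is a fin_num) ->
      'N[nu]_q[u] <= M%:E ->
      forall A, measurable A ->
        \int[nu]_(x in A) `|u x| <= K%:E * nu A + eps%:E.
Proof.
case: q => [q| |//] q1 M0 eps0; last first.
  (* For infinite q the function is bounded by [M] almost everywhere. *)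
  exists M => // nu u mu_ ufin; rewrite unlock.
  have -> : 0 < nu [set: T] by rewrite [X in _ < X]probability_setT.
  move=> /ess_supP uM A mA.
  rewrite (@le_trans _ _ (\int[nu]_(x in A) M%:E))//.
    apply: ae_ge0_le_integral => //.
    - by apply: measurableT_comp => //; exact: measurable_funTS.
    - by move=> x _; rewrite lee_fin ltW.
    - by apply: filterS uM.
  by rewrite integral_cst// leeDl// lee_fin ltW.
rewrite lte_fin in q1; have q0 : (0 < q)%R by rewrite (lt_trans _ q1).
have q10 : (0 < q - 1)%R by rewrite subr_gt0.
(* The solution of M^q / K^(q - 1) = eps. *)
pose K := ((M `^ q / eps) `^ (q - 1)^-1)%R.
have K0 : (0 < K)%R by rewrite powR_gt0// divr_gt0// powR_gt0.
have KE : (K `^ (q - 1) = M `^ q / eps)%R.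
  rewrite /K -powRrM mulVf ?gt_eqF// powRr1//.
  by rewrite divr_ge0 ?powR_ge0// ltW.
exists K => // nu u mu_ ufin uM A mA.
have Mq0 : (0 < M `^ q)%R by rewrite powR_gt0.
have uq : \int[nu]_x `|u x| `^ q <= (M `^ q)%:E.
  rewrite -poweR_Lnorm ?gt_eqF// -poweR_EFin.
  apply: gt0_ler_poweR => //; first exact: ltW.
  - by rewrite in_itv/= leey andbT Lnorm_ge0.
  - by rewrite in_itv/= leey andbT lee_fin ltW.
have muq : measurable_fun [set: T] (fun x => `|u x| `^ q).
  apply: (measurableT_comp (measurable_poweR _)).
  exact: measurableT_comp.
have eM0 : 0 <= (eps / M `^ q)%:E by rewrite lee_fin divr_ge0// ltW.
apply: (@le_trans _ _ (\int[nu]_(x in A) (K%:E + (eps / M `^ q)%:E * `|u x| `^ q))).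
  apply: ge0_le_integral => //.
  - exact: measurableT_comp (measurable_funTS mu_).
  - by apply: emeasurable_funD => //; apply: measurable_funeM; exact: measurable_funTS.
  - move=> x _; rewrite -(fineK (ufin x)) /= -EFinM -EFinD lee_fin.
    have := le_add_powR q1 K0 (normr_ge0 (fine (u x))).
    by rewrite KE invf_div => /le_trans; apply; rewrite lerD2l [leLHS]mulrC.
have muqA : measurable_fun A (fun x => (eps / M `^ q)%:E * `|u x| `^ q).
  by apply: measurable_funeM; exact: measurable_funTS.
have uq0 x : 0 <= (eps / M `^ q)%:E * `|u x| `^ q by rewrite mule_ge0// poweR_ge0.
rewrite ge0_integralD//; last by move=> x _; rewrite lee_fin ltW.
rewrite integral_cst//; apply: leeD2l.
apply: (@le_trans _ _ (\int[nu]_x ((eps / M `^ q)%:E * `|u x| `^ q))).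
  by apply: ge0_subset_integral => //; exact: measurable_funeM.
rewrite ge0_integralZl//; last by move=> x _; exact: poweR_ge0.
apply: (le_trans (lee_wpmul2l eM0 uq)).
by rewrite -EFinM divfK// gt_eqF.
Qed.

End truncation.

(** * Consequences of very weak reversibility for cuts *)

Section very_weak_reversible_bound.
Context d (T : measurableType d) (R : realType).
Variables (p : R.-pker T ~> T) (mu : probability T R) (n : nat).
Hypothesis eqv : equivalent_step_laws p mu n.
Hypothesis vwr : very_weak_reversible p mu n.
Local Notation k := (nstep p n).

Lemma measurable_step_density : measurable_fun [set: T * T] (step_density p mu n).
Proof.
have [numu _] := eqv; exact: measurable_int (@Radon_Nikodym_integrable _ _ _
  (charge_of_finite_measure (step_law p mu n)) (reversed_step_law p mu n) numu).
Qed.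

(** Change of measure from [step_law] to [reversed_step_law]. The derivative is that of a charge;
    passing to its absolute value avoids discussing its sign, and only an upper bound is wanted. *)
Lemma integral_kernel_density_le (g : T * T -> \bar R) :
  measurable_fun [set: T * T] g -> (forall z, 0 <= g z <= 1) ->
  \int[mu]_x \int[k x]_y g (x, y) <=
  \int[mu]_y \int[k y]_x (g (x, y) * `|step_density p mu n (x, y)|).
Proof.
move=> mg g01; have g0 z : 0 <= g z by have /andP[] := g01 z.
have mh := measurable_step_density.
have mgh : measurable_fun [set: T * T] (fun z => g z * `|step_density p mu n z|).
  by apply: emeasurable_funM => //; exact: measurableT_comp.
have gh0 z : 0 <= g z * `|step_density p mu n z| by rewrite mule_ge0.
rewrite -integral_joint_law// -(integral_reversed_law mu k mgh gh0).
have ig : (step_law p mu n).-integrable setT g.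
  apply/integrableP; split => //.
  apply: (@le_lt_trans _ _ (\int[step_law p mu n]_z 1)).
    apply: ge0_le_integral => //; first exact: measurableT_comp.
    by move=> z _; rewrite gee0_abs//; have /andP[] := g01 z.
  by rewrite integral_cst_probability ltry.
rewrite -(Radon_Nikodym_change_of_variables eqv.1 measurableT ig).
apply: (@le_trans _ _ `|\int[reversed_step_law p mu n]_z (g z * step_density p mu n z)|).
  exact: lee_abs.
apply: le_trans (le_abse_integral _ measurableT _) _.
  exact: emeasurable_funM.
by under eq_integral do rewrite abseM gee0_abs//.
Qed.

(** The 2n steps are cut at the midpoint [y], and the change of measure draws the starting point
    from [k y], weighted by the density. Truncation under [k y] produces K k(y, A) + eps, and eps
    k(y, B) averages to eps mu(B) by invariance. *)
Lemma cut_two_steps_le (eps : R) : invariant_measure p mu -> (0 < eps)%R ->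
  exists2 K : R, (0 < K)%R &
    forall A B, measurable A -> measurable B ->
      \int[mu]_(x in A) nstep p (2 * n) x B <=
      K%:E * \int[mu]_y (k y A * k y B) + eps%:E * mu B.
Proof.
move=> mu_inv eps0; have [q q1 qy] := vwr.
have [M M0 hM] : exists2 M : R, (0 < M)%R & \forall y \ae mu,
    'N[k y]_q[(fun x => step_density p mu n (x, y))] <= M%:E.
  move: qy; set E := ess_sup mu _ => Ey.
  (* The maximum with 1 gives a positive bound whatever the value of the essential supremum. *)
  exists (Num.max 1 (fine E))%R; first by rewrite lt_max ltr01.
  apply/ess_supP; rewrite -/E; move: Ey; case: E => [r _| |] //=.
    by rewrite lee_fin le_max lexx orbT.
  by move=> _; rewrite leNye.
have [K K0 hK] := @integral_le_of_Lnorm _ T R _ _ _ q1 M0 eps0.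
exists K => // A B mA mB.
have mkA C : measurable C -> measurable_fun [set: T] (fun y => k y C).
  by move=> mC; exact: measurable_kernel.
have kle1 y C : measurable C -> k y C <= 1.
  by move=> mC; exact: (probability_le1 (kernel_prob k y)).
(* Averaged over the first n steps, [g] gives 1_A(x) times the 2n-step mass of [B]. *)
pose g (z : T * T) := (\1_A z.1)%:E * k z.2 B.
have mg : measurable_fun [set: T * T] g.
  apply: emeasurable_funM.
    apply/measurable_EFinP; apply: (measurableT_comp (measurable_indic mA)).
    exact: measurable_fst.
  exact: (measurableT_comp (mkA _ mB)).
have g01 z : 0 <= g z <= 1.
  rewrite /g indicE; case: (_ \in _); rewrite ?mul1e ?mul0e ?lexx ?lee01//.
  by rewrite measure_ge0 kle1.
rewrite (_ : \int[mu]_(x in A) _ = \int[mu]_x \int[k x]_y g (x, y)); last first.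
  rewrite integral_mkcond; apply: eq_integral => x _; rewrite patchE /g/=.
  rewrite ge0_integralZl//; last exact: mkA.
  rewrite indicE mul2n -addnn; case: ifPn => xA; rewrite ?mul1e ?mul0e//.
  exact: nstepD.
apply: (le_trans (integral_kernel_density_le mg g01)).
have fin_h z : step_density p mu n z \is a fin_num.
  exact: (@Radon_Nikodym_fin_num _ _ _
    (charge_of_finite_measure (step_law p mu n)) (reversed_step_law p mu n) _ eqv.1).
have mh y : measurable_fun [set: T] (fun x => step_density p mu n (x, y)).
  exact: (measurableT_comp measurable_step_density).
have mAB : measurable_fun [set: T] (fun y => k y A * k y B).
  by apply: emeasurable_funM; exact: mkA.
have kB : \int[mu]_y k y B = mu B by exact: nstep_invariant.
rewrite -kB -!ge0_integralZl//; [|exact: mkA|by rewrite lee_fin ltW..].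
rewrite -ge0_integralD//.
all: try by [apply: measurable_funeM => //; exact: mkA
            |move=> y _; rewrite mule_ge0// ?mule_ge0// lee_fin ltW].
pose gh (z : T * T) := g z * `|step_density p mu n z|.
have mgh : measurable_fun [set: T * T] gh.
  have := measurable_step_density => mdens.
  by apply: emeasurable_funM => //; exact: measurableT_comp.
have gh0 z : 0 <= gh z by rewrite mule_ge0//; have /andP[] := g01 z.
apply: ae_ge0_le_integral => //.
- by move=> y _; apply: integral_ge0 => x _; exact: gh0.
- apply: (measurable_fun_integral_finite_kernel (gh \o @swap_pair T T)) => //.
    by move=> z; exact: gh0.
  by apply: (measurableT_comp mgh); exact: measurable_swap.
- by move=> y _; rewrite adde_ge0 ?mule_ge0 ?lee_fin// ltW.
- by apply: emeasurable_funD; apply: measurable_funeM => //; exact: mkA.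
apply: filterS hM => y hy _.
rewrite [leLHS](_ : _ =
    k y B * \int[k y]_(x in A) `|step_density p mu n (x, y)|); last first.
  rewrite [in RHS]integral_mkcond -ge0_integralZl//.
  - apply: eq_integral => x _; rewrite /g patchE indicE /=.
    by case: ifPn => _; rewrite ?mul1e// !mul0e mule0.
  - apply/(measurable_restrictT _ mA).
    by apply: measurableT_comp => //; exact: measurable_funTS.
  - by move=> x _; rewrite patchE; case: ifPn.
rewrite -kernel_probE in hy.
have hk := hK (kernel_prob k y) _ (mh y) (fun x => fin_h _) hy A mA.
apply: (@le_trans _ _ (k y B * (K%:E * k y A + eps%:E))); first exact: lee_wpmul2l.
rewrite ge0_muleDr ?mule_ge0 ?lee_fin ?(ltW K0) ?(ltW eps0)//.
by rewrite (muleC (k y B) (K%:E * _)) -muleA (muleC (k y B) eps%:E).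
Qed.

End very_weak_reversible_bound.

(** * From isoperimetry to contraction *)

Section isoperimetry.
Context d (T : measurableType d) (R : realType).
Variables (p : R.-pker T ~> T) (mu : probability T R).

(** Sets of measure 0 or 1, which the infimum excludes, satisfy the bound because the product
    vanishes. *)
Lemma isoperimetric_constant_gt0 m : 0 < isoperimetric_constant p mu m ->
  exists2 c : R, (0 < c)%R & forall A, measurable A ->
    c%:E * (mu A * mu (~` A)) <= \int[mu]_(x in A) nstep p m x (~` A).
Proof.
move=> I0; have [c c0 cI] : exists2 c : R,
    (0 < c)%R & c%:E <= isoperimetric_constant p mu m.
  move: I0; case: isoperimetric_constant => [r|_|//]; last first.
    (* The value [+oo], as for an empty infimum, allows any positive constant. *)
    by exists 1%R => //; rewrite leey.
  by rewrite lte_fin => r0; exists r.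
exists c => // A mA; have int0 : 0 <= \int[mu]_(x in A) nstep p m x (~` A).
  exact: integral_ge0.
have [A0|A0] := eqVneq (mu A) 0; first by rewrite A0 mul0e mule0.
have [A1|A1] := eqVneq (mu A) 1.
  by rewrite probability_setC// A1 subee// mule0 mule0.
have A01 : 0 < mu A < 1.
  by rewrite lt0e A0 measure_ge0/= lt_neqAle A1 probability_le1.
have [a aE] : exists a, mu A = a%:E.
  by exists (fine (mu A)); rewrite fineK// fin_num_measure.
have /(le_trans cI) : isoperimetric_constant p mu m <=
    (\int[mu]_(x in A) nstep p m x (~` A)) / (mu A * mu (~` A)).
  by apply: ereal_inf_lbound; exists A.
move: A01; rewrite probability_setC// aE -EFinB -EFinM !lte_fin => /andP[a0 a1].
have v0 : (0 < a * (1 - a))%R by rewrite mulr_gt0// subr_gt0.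
by rewrite inver gt_eqF// lee_pdivlMr.
Qed.

Variable n : nat.
Hypothesis mu_inv : invariant_measure p mu.
Hypothesis eqv : equivalent_step_laws p mu n.
Hypothesis vwr : very_weak_reversible p mu n.
Local Notation k := (nstep p n).

(** If mu(A^c) <= 1/2 then mu(A) >= 1/2, so the error (h/4) mu(A^c) is at most half of h mu(A)
    mu(A^c); the other half yields the constant h / (2 K). *)
Lemma sibling_law_cut : 0 < isoperimetric_constant p mu (2 * n) ->
  exists2 c : R, (0 < c)%R & forall A, measurable A ->
    c%:E * (mu A * mu (~` A)) <= sibling_law mu k (A `*` ~` A).
Proof.
move=> /isoperimetric_constant_gt0[h h0 hA].
have [K K0 hK] := cut_two_steps_le eqv vwr mu_inv (divr_gt0 h0 (ltr0n _ 4)).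
have c0 : (0 < h / (2 * K))%R by rewrite divr_gt0// mulr_gt0.
exists (h / (2 * K))%R => //.
have large B : measurable B -> mu (~` B) <= 2^-1%:E ->
    (h / (2 * K))%:E * (mu B * mu (~` B)) <= \int[mu]_y (k y B * k y (~` B)).
  move=> mB; have mCB := measurableC mB.
  have := le_trans (hA _ mB) (hK _ _ mB mCB).
  have : 0 <= \int[mu]_y (k y B * k y (~` B)).
    by apply: integral_ge0 => y _; rewrite mule_ge0.
  have [b bE] : exists b, mu B = b%:E.
    by exists (fine (mu B)); rewrite fineK// fin_num_measure.
  rewrite probability_setC// bE -EFinB -EFinM.
  case: (\int[mu]_y _) => [s| |//]; last by move=> _ _ _; rewrite leey.
  rewrite -!EFinM -EFinD !lee_fin => s0 hs bhalf.
  rewrite -mulrA [((2 * K)^-1 * _)%R]mulrC mulrA ler_pdivrMr ?mulr_gt0//.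
  have b1 : (0 <= 1 - b)%R by rewrite subr_ge0 -lee_fin -bE probability_le1.
  have b2 : (0 <= b - 2^-1)%R by lra.
  have := mulr_ge0 (mulr_ge0 (ltW h0) b1) b2; nra.
move=> A mA; have mCA := measurableC mA; rewrite sibling_lawX//.
have [Ahalf|Ahalf] := leP (mu (~` A)) 2^-1%:E; first exact: large.
(* The integral of k(y, A) k(y, A^c) is symmetric in the two sets, so this case is the first one for
   the complement. *)
have := large _ mCA; rewrite setCK muleC => Alarge.
under eq_integral do rewrite muleC.
rewrite (muleC (mu A)) muleC; apply: Alarge.
move: Ahalf; rewrite probability_setC//.
have [b ->] : exists b, mu A = b%:E.
  by exists (fine (mu A)); rewrite fineK// fin_num_measure.
by rewrite -EFinB lte_fin lee_fin; lra.
Qed.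

(** Cheeger's inequality bounds the Dirichlet form below by (c^2/16) |f|^2; inserted into
    [markov_op_dirichlet] it gives 2 |P^n f|^2 <= (2 - c^2/16) |f|^2. *)
Lemma markov_op_L2_contraction : 0 < isoperimetric_constant p mu (2 * n) ->
  exists2 rho : R, (0 <= rho < 1)%R &
    forall f : T -> R, measurable_fun [set: T] f ->
      \int[mu]_x (f x ^+ 2)%:E < +oo -> \int[mu]_x (f x)%:E = 0 ->
      \int[mu]_x (iter n (markov_op p) f x ^+ 2)%:E <=
        rho%:E * \int[mu]_x (f x ^+ 2)%:E.
Proof.
move=> /sibling_law_cut[c c0 hc].
have k_inv := nstep_invariant mu_inv n.
have S_fst (F : T -> \bar R) : measurable_fun [set: T] F ->
    (forall x, 0 <= F x) -> \int[sibling_law mu k]_z F z.1 = \int[mu]_x F x.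
  move=> mF F0; rewrite integral_sibling_law//; last exact: (measurableT_comp mF).
  rewrite -(integral_invariant k_inv mF F0); apply: eq_integral => y _.
  by apply: eq_integral => x _; rewrite -kernel_probE /= integral_cst_probability.
have S_snd (F : T -> \bar R) : measurable_fun [set: T] F ->
    (forall x, 0 <= F x) -> \int[sibling_law mu k]_z F z.2 = \int[mu]_x F x.
  move=> mF F0; rewrite integral_sibling_law//; last exact: (measurableT_comp mF).
  rewrite -(integral_invariant k_inv mF F0); apply: eq_integral => y _.
  by rewrite -kernel_probE /= integral_cst_probability.
(* The maximum with 0 makes the constant nonnegative without an upper bound on [c]. *)
exists (Num.max 0 (1 - c ^+ 2 / 32))%R.
  by rewrite le_max lexx/= gt_max ltr01 ltrBlDr ltrDl divr_gt0 ?exprn_gt0.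
move=> f mf fy f0; have intf := integrable_of_sqr mf fy.
have mM := measurable_markov_op k mf.
rewrite (ge0_ae_eq_integral (g := fun x => (markov_op k f x ^+ 2)%:E))//; first last.
- by apply: filterS (iter_markov_op_ae mu_inv n intf) => x -> _.
- by move=> x _; rewrite lee_fin sqr_ge0.
- by move=> x _; rewrite lee_fin sqr_ge0.
- exact: measurable_sqr.
- by apply: measurable_sqr; exact: measurable_iter_markov_op.
have ch : (c ^+ 2 / 16)%:E * \int[mu]_x (f x ^+ 2)%:E <=
    \int[sibling_law mu k]_z ((f z.1 - f z.2) ^+ 2)%:E.
  pose F : {RV mu >-> R} := mfun_Sub (mem_set mf).
  exact: (cheeger_inequality c0 S_fst S_snd hc (f := F)).
have := le_trans (leeD2l _ ch) (markov_op_dirichlet k_inv mf).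
have My := le_lt_trans (markov_op_contraction k_inv mf) fy.
have : 0 <= \int[mu]_x (f x ^+ 2)%:E.
  by apply: integral_ge0 => x _; rewrite lee_fin sqr_ge0.
move: fy; case: (\int[mu]_x (f x ^+ 2)%:E) => [s| |//] // _ s0.
have : 0 <= \int[mu]_x (markov_op k f x ^+ 2)%:E.
  by apply: integral_ge0 => x _; rewrite lee_fin sqr_ge0.
move: My; case: (\int[mu]_x (markov_op k f x ^+ 2)%:E) => [r| |//] _ // _.
rewrite -!EFinM -EFinD !lee_fin in s0 * => hr.
rewrite (@le_trans _ _ ((1 - c ^+ 2 / 32) * s)%R)//; first by lra.
by rewrite ler_wpM2r// le_max lexx orbT.
Qed.

End isoperimetry.

(** * Limit of the roots of a submultiplicative sequence *)

Section submultiplicative_root.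
Context (R : realType) (X : Type) (L : set X) (e : nat -> X -> R).
Hypothesis L0 : L !=set0.
Hypothesis e01 : forall n x, L x -> (0 <= e n x <= 1)%R.
Hypothesis e_sub : forall m k c c' , (0 <= c)%R -> (0 <= c')%R ->
  (forall x, L x -> e m x <= c)%R -> (forall x, L x -> e k x <= c')%R ->
  (forall x, L x -> e (m + k) x <= c * c')%R.

Let a n : \bar R := ereal_sup [set (e n x `^ n%:R^-1)%:E | x in L].

Let a_ge0 n : 0 <= a n.
Proof.
have [x Lx] := L0; apply: (@le_trans _ _ (e n x `^ n%:R^-1)%:E).
  by rewrite lee_fin powR_ge0.
by apply: ereal_sup_ubound; exists x.
Qed.

Let a_le1 n : a n <= 1.
Proof.
apply: ge_ereal_sup => _ [x Lx <-]; rewrite lee_fin.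
have /andP[e0 e1] := e01 n Lx.
apply: (@le_trans _ _ (1 `^ n%:R^-1)%R); last by rewrite powR1.
by rewrite ge0_ler_powR// nnegrE.
Qed.

(** Peels off [q] blocks of length [k]; the remainder [r] contributes a factor at most 1 by
    [e01]. *)
Let e_pow k c q r : (0 <= c)%R -> (forall x, L x -> e k x <= c)%R ->
  (forall x, L x -> e (k * q + r) x <= c ^+ q)%R.
Proof.
move=> c0 ek; elim: q => [|q IH] x Lx.
  by rewrite muln0 add0n expr0; have /andP[] := e01 r Lx.
rewrite mulnS -addnA exprS; apply: e_sub => //; exact: exprn_ge0.
Qed.

(** With c strictly between [a k] and [b], blocks of length [k] give e n <= c^(n - k), whose n-th
    root c^(1 - k/n) drops below [b] for large n. *)
Let a_near_le (b : R) k : (0 < k)%N -> a k < b%:E -> \forall n \near \oo, a n <= b%:E.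
Proof.
move=> k0 akb; have [b1|b1] := leP 1%R b.
  by apply: nearW => n; apply: le_trans (a_le1 n) _; rewrite lee_fin.
have [r rE] : exists r, a k = r%:E.
  exists (fine (a k)); rewrite fineK// ge0_fin_numE//.
  by apply: le_lt_trans (a_le1 k) _; rewrite ltry.
have r0 : (0 <= r)%R by rewrite -lee_fin -rE.
have rb : (r < b)%R by rewrite -lte_fin -rE.
pose c := ((r + b) / 2)%R.
have rc : (r < c)%R by rewrite /c; lra.
have cb : (c < b)%R by rewrite /c; lra.
have c0 : (0 < c)%R by exact: le_lt_trans rc.
have c1 : (c < 1)%R by exact: lt_trans b1.
have ek x : L x -> (e k x <= c ^+ k)%R.
  move=> Lx; have /andP[ex0 _] := e01 k Lx.
  have : (e k x `^ k%:R^-1 <= c)%R.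
    rewrite -lee_fin; apply: (@le_trans _ _ (a k)); last by rewrite rE lee_fin ltW.
    by apply: ereal_sup_ubound; exists x.
  have eE : ((e k x `^ k%:R^-1) ^+ k = e k x)%R.
    by rewrite -powR_mulrn ?powR_ge0// -powRrM mulVf ?powRr1// pnatr_eq0 -lt0n.
  by rewrite -(@ler_pXn2r _ k)// ?nnegrE ?powR_ge0 ?(ltW c0)// eE.
(* Then c^t = b with t < 1, so 1 - k/n >= t suffices, that is n >= k / (1 - t). *)
pose t := (ln b / ln c)%R.
have b0 : (0 < b)%R by exact: lt_trans cb.
have lnc : (ln c < 0)%R by rewrite -ln1 ltr_ln ?posrE.
have tb : (c `^ t = b)%R.
  by rewrite /powR gt_eqF// /t divfK ?lt_eqF// lnK ?posrE.
have t1 : (t < 1)%R by rewrite /t ltr_ndivrMr// mul1r ltr_ln ?posrE.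
have [N hN] : exists N : nat, (k%:R / (1 - t) <= N%:R :> R)%R.
  exists (Num.truncn (k%:R / (1 - t))%R).+1; exact/ltW/truncnS_gt.
exists (maxn N k.+1) => // n /=; rewrite geq_max => /andP[Nn kn].
apply: ge_ereal_sup => _ [x Lx <-]; rewrite lee_fin.
have n0 : (0 < n%:R :> R)%R by rewrite ltr0n (leq_trans _ kn).
have : (e n x <= c ^+ (n - k))%R.
  have := e_pow (n %/ k) (n %% k) (exprn_ge0 k (ltW c0)) ek Lx.
  rewrite mulnC -divn_eq => /le_trans; apply.
  rewrite -exprM ler_wiXn2l ?ltW//; last first.
  by rewrite leq_subLR mulnC {1}(divn_eq n k) addnC leq_add2r ltnW ?ltn_pmod.
have /andP[ex0 _] := e01 n Lx.
move=> /(ge0_ler_powR (r := n%:R^-1)).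
rewrite ?nnegrE invr_ge0 ler0n ex0 exprn_ge0 ?(ltW c0)//.
move=> /(_ isT isT isT) /le_trans; apply.
rewrite -tb -powR_mulrn ?(ltW c0)// -powRrM.
rewrite ger_powR ?c0 ?(ltW c1)// ler_pdivlMr//.
have kn' : (k <= n)%N by exact: ltnW.
rewrite (natrB _ kn').
have hk : (k%:R <= N%:R * (1 - t))%R by rewrite -ler_pdivrMr ?subr_gt0.
have hn : (N%:R * (1 - t) <= n%:R * (1 - t))%R.
  by rewrite ler_wpM2r ?ler_nat// subr_ge0 ltW.
have := le_trans hk hn; rewrite mulrBr mulr1 (mulrC t); lra.
Qed.

(** Fekete's argument: every [a n] with n > 0 lies above the infimum, and [a_near_le] at a
    near-minimal [k] bounds the tail from above. *)
Lemma cvg_submultiplicative_root :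
  a @ \oo --> ereal_inf [set a n | n in [set n | (0 < n)%N]].
Proof.
set l := ereal_inf _.
have l_le n : (0 < n)%N -> l <= a n by move=> n0; apply: ereal_inf_lbound; exists n.
have l0 : 0 <= l by apply: le_ereal_inf_tmp => _ [n _ <-].
have lfin : l \is a fin_num.
  by rewrite ge0_fin_numE// (le_lt_trans (l_le 1%N _))// (le_lt_trans (a_le1 1))// ltry.
have aE n : a n = (fine (a n))%:E.
  by rewrite fineK// ge0_fin_numE// (le_lt_trans (a_le1 n))// ltry.
rewrite -(fineK lfin); apply: cvg_EFin; first by apply: nearW => n; rewrite aE.
apply/cvgrPdist_le => eps eps0.
have [_ [k k0 <-]] := lb_ereal_inf_adherent eps0 lfin.
rewrite -/l -{1}(fineK lfin) -EFinD => /(a_near_le k0).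
apply: filter_app; exists 1%N => // n /= n1 an.
rewrite ler_distlC; apply/andP; split; last by rewrite -lee_fin -aE.
rewrite lerBlDr (@le_trans _ _ (fine (a n)))//; last by rewrite lerDl ltW.
by rewrite -lee_fin -aE fineK// l_le.
Qed.

End submultiplicative_root.

(** * Flows out of a set and the spectral gap *)

Section spectral_gap.
Context d (T : measurableType d) (R : realType).
Variables (p : R.-pker T ~> T) (mu : probability T R).
Hypothesis mu_inv : invariant_measure p mu.

(** To be outside [A] after m + k steps, the chain is already outside after [m], or it is in [A]
    then and outside [k] steps later. Once the start in [A] is forgotten, invariance turns the
    second mass into the k-step flow. *)
Lemma flow_le_sum m k A : measurable A ->
  \int[mu]_(x in A) nstep p (m + k) x (~` A) <=
  \int[mu]_(x in A) nstep p m x (~` A) + \int[mu]_(x in A) nstep p k x (~` A).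
Proof.
move=> mA; have mCA := measurableC mA.
have mk i C : measurable C -> measurable_fun [set: T] (fun x => nstep p i x C).
  by move=> mC; exact: measurable_kernel.
have mkA : measurable_fun [set: T] (fun y => (\1_A y)%:E * nstep p k y (~` A)).
  by apply: emeasurable_funM; [exact/measurable_EFinP/measurable_indic|exact: mk].
have kA0 y : 0 <= (\1_A y)%:E * nstep p k y (~` A) by rewrite mule_ge0 ?lee_fin.
have int0 x : 0 <= \int[nstep p m x]_y ((\1_A y)%:E * nstep p k y (~` A)).
  exact: integral_ge0.
have mint : measurable_fun [set: T]
    (fun x => \int[nstep p m x]_y ((\1_A y)%:E * nstep p k y (~` A))).
  exact: measurable_integral_kernel.
apply: (@le_trans _ _ (\int[mu]_(x in A) (nstep p m x (~` A) +
    \int[nstep p m x]_y ((\1_A y)%:E * nstep p k y (~` A))))).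
  apply: ge0_le_integral => //.
  - exact/measurable_funTS/mk.
  - by apply: emeasurable_funD; apply: measurable_funTS => //; exact: mk.
  move=> x _; rewrite nstepD//.
  rewrite -[X in _ <= X + _](_ : \int[nstep p m x]_y (\1_(~` A) y)%:E = _); last first.
    by rewrite integral_indic// setIT.
  rewrite -ge0_integralD//; last first.
    by apply/measurable_EFinP/measurable_indic.
  apply: ge0_le_integral => //.
  - exact: mk.
  - by apply: emeasurable_funD => //; apply/measurable_EFinP/measurable_indic.
  - move=> y _; rewrite !indicE in_setC; case: (y \in A); rewrite /= ?mul1e ?add0e//.
    by rewrite mul0e adde0; exact: (probability_le1 (kernel_prob (nstep p k) y)).
rewrite ge0_integralD//; last 2 first.
- exact/measurable_funTS/mk.
- exact: measurable_funTS.
apply: leeD2l.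
apply: (@le_trans _ _ (\int[mu]_x
    \int[nstep p m x]_y ((\1_A y)%:E * nstep p k y (~` A)))).
  exact: ge0_subset_integral.
rewrite integral_invariant//; last exact: nstep_invariant.
rewrite [leRHS]integral_mkcond le_eqVlt; apply/orP; left; apply/eqP.
apply: eq_integral => y _; rewrite patchE indicE.
by case: ifPn; rewrite ?mul1e ?mul0e.
Qed.

Lemma flow_le_muln m j A : measurable A ->
  \int[mu]_(x in A) nstep p (m * j.+1) x (~` A) <=
  j.+1%:R%:E * \int[mu]_(x in A) nstep p m x (~` A).
Proof.
move=> mA; elim: j => [|j IH]; first by rewrite muln1 mul1e.
rewrite mulnS; apply: (le_trans (flow_le_sum _ _ mA)).
have -> : (j.+2%:R%:E : \bar R) = 1 + j.+1%:R%:E by rewrite -EFinD addrC natr1.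
by rewrite ge0_muleDl ?lee_fin// mul1e leeD2l.
Qed.

Lemma Lnorm2E (f : T -> R) :
  'N[mu]_2%:E[EFin \o f] = (\int[mu]_x (f x ^+ 2)%:E) `^ 2^-1.
Proof.
rewrite unlock; congr (_ `^ _); apply: eq_integral => x _ /=.
by rewrite powR_mulrn// real_normK// num_real.
Qed.

Lemma L2_normalizedP (f : T -> R) : L2_normalized mu f <->
  [/\ measurable_fun [set: T] f, \int[mu]_x (f x)%:E = 0 &
      \int[mu]_x (f x ^+ 2)%:E = 1].
Proof.
split=> [[fL f0 f1]|[mf f0 f1]].
  by split => //; move: fL; rewrite inE => /andP[]; rewrite inE.
split => //; rewrite inE; apply/andP; split; rewrite inE//=.
by rewrite /finite_norm Lnorm2E f1 poweR1r ltry.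
Qed.

Let E (f : T -> R) := \int[mu]_x (f x ^+ 2)%:E.

Let E_ge0 f : 0 <= E f.
Proof. by apply: integral_ge0 => x _; rewrite lee_fin sqr_ge0. Qed.

Lemma integral_sqrZ (a : R) (f : T -> R) : measurable_fun [set: T] f ->
  \int[mu]_x ((a * f x) ^+ 2)%:E = (a ^+ 2)%:E * \int[mu]_x (f x ^+ 2)%:E.
Proof.
move=> mf; under eq_integral do rewrite exprMn EFinM.
by rewrite ge0_integralZl// ?lee_fin ?sqr_ge0//; [exact: measurable_sqr|
   move=> x _; rewrite lee_fin sqr_ge0].
Qed.

(** The two claims share one induction: preserving the mean requires the current iterate to be
    integrable, which its second moment provides. *)
Lemma iter_markov_op_L2 m (f : T -> R) : measurable_fun [set: T] f ->
  \int[mu]_x (f x ^+ 2)%:E < +oo ->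
  \int[mu]_x (iter m (markov_op p) f x ^+ 2)%:E <= \int[mu]_x (f x ^+ 2)%:E /\
  \int[mu]_x (iter m (markov_op p) f x)%:E = \int[mu]_x (f x)%:E.
Proof.
move=> mf fy; elim: m => //= m [IH1 IH2].
have mI := measurable_iter_markov_op p m mf.
split; first exact: le_trans (markov_op_contraction mu_inv mI) IH1.
rewrite integral_markov_op//; apply: integrable_of_sqr => //.
exact: le_lt_trans fy.
Qed.

(** The L^2 norm of P^n f; [fine] loses nothing for normalized [f], whose iterates have second
    moment at most 1. *)
Let e n (f : T -> R) : R :=
  Num.sqrt (fine (\int[mu]_x (iter n (markov_op p) f x ^+ 2)%:E)).

Let energyE n f : L2_normalized mu f -> E (iter n (markov_op p) f) = (e n f ^+ 2)%:E.
Proof.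
move=> /L2_normalizedP[mf f0 f1].
have [|+ _] := @iter_markov_op_L2 n f mf; first by rewrite f1 ltry.
rewrite f1 => le1; rewrite /e sqr_sqrtr ?fineK// ?fine_ge0 ?E_ge0//.
by rewrite ge0_fin_numE ?E_ge0// (le_lt_trans le1)// ltry.
Qed.

Let e_le n f (c : R) : L2_normalized mu f -> (0 <= c)%R ->
  (e n f <= c)%R <-> E (iter n (markov_op p) f) <= (c ^+ 2)%:E.
Proof.
by move=> Lf c0; rewrite energyE// lee_fin ler_sqr// nnegrE// sqrtr_ge0.
Qed.

Let e01 n f : L2_normalized mu f -> (0 <= e n f <= 1)%R.
Proof.
move=> Lf; rewrite sqrtr_ge0/=; apply/e_le => //; rewrite expr1n.
have /L2_normalizedP[mf f0 f1] := Lf.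
have [|+ _] := @iter_markov_op_L2 n f mf; first by rewrite f1 ltry.
by rewrite f1.
Qed.

(** P^k f, whose mean is still 0, is rescaled to norm one before the bound for P^m is applied. *)
Let e_sub m k c c' : (0 <= c)%R -> (0 <= c')%R ->
  (forall f, L2_normalized mu f -> e m f <= c)%R ->
  (forall f, L2_normalized mu f -> e k f <= c')%R ->
  (forall f, L2_normalized mu f -> e (m + k) f <= c * c')%R.
Proof.
move=> c0 c'0 em ek f Lf; apply/e_le => //; first exact: mulr_ge0.
have /L2_normalizedP[mf f0 f1] := Lf.
set g := iter k (markov_op p) f.
have mg : measurable_fun [set: T] g by exact: measurable_iter_markov_op.
have gE : E g = (e k f ^+ 2)%:E by exact: energyE.
have [_ gf] : E g <= E f /\ \int[mu]_x (g x)%:E = \int[mu]_x (f x)%:E.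
  by apply: iter_markov_op_L2 => //; rewrite f1 ltry.
(* If P^k f has norm 0 it cannot be rescaled, but then contraction makes the left side 0. *)
have [s0|s0] := eqVneq (e k f) 0%R.
  rewrite iterD -/g; have [|le_g _] := @iter_markov_op_L2 m g mg.
    by rewrite [X in X < _]gE ltry.
  apply: (le_trans le_g); rewrite [leLHS]gE s0 expr0n/= lee_fin.
  by rewrite sqr_ge0.
have Lg : L2_normalized mu (fun x => (e k f)^-1 * g x)%R.
  apply/L2_normalizedP; split.
  - exact: measurable_funM.
  - under eq_integral do rewrite EFinM.
    rewrite integralZl ?gf ?f0 ?mule0//; apply: integrable_of_sqr => //.
    by rewrite [X in X < _]gE ltry.
  - by rewrite integral_sqrZ// [X in _ * X]gE -EFinM -exprMn mulVf// expr1n.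
have := (e_le m Lg c0).1 (em _ Lg).
rewrite iter_markov_opZ// /E integral_sqrZ; last exact: measurable_iter_markov_op.
rewrite -iterD; have := E_ge0 (iter (m + k) (markov_op p) f); rewrite /E.
have e0 : (0 < e k f)%R by rewrite lt0r s0 sqrtr_ge0.
case: (\int[mu]_x _) => [y| |//] _; last first.
  by rewrite gt0_muley// lte_fin exprn_gt0// invr_gt0.
rewrite -EFinM !lee_fin exprVn ler_pdivrMl ?exprn_gt0// => /le_trans; apply.
rewrite exprMn mulrC ler_wpM2l ?sqr_ge0// ler_sqr ?nnegrE//; last exact: ltW.
exact: ek.
Qed.

Let rate n : \bar R := ereal_sup [set (e n f `^ n%:R^-1)%:E | f in L2_normalized mu].

Let L2_spectral_gapE :
  L2_spectral_gap p mu <-> exists2 l : \bar R, rate @ \oo --> l & l < 1.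
Proof.
rewrite /L2_spectral_gap (_ : (fun n : nat => ereal_sup _) = rate)//.
apply/funext => n; congr ereal_sup; apply: eq_imagel => f Lf.
rewrite Lnorm2E; have := energyE n Lf; rewrite /E => ->.
by rewrite !poweR_EFin powR12_sqrt ?sqr_ge0// sqrtr_sqr ger0_norm// sqrtr_ge0.
Qed.

Let rate_lt1 n (c : R) : (0 < n)%N -> (0 <= c < 1)%R ->
  (forall f, L2_normalized mu f -> e n f <= c)%R -> rate n < 1.
Proof.
move=> n0 /andP[c0 c1] ec; apply: (@le_lt_trans _ _ (c `^ n%:R^-1)%:E).
  apply: ge_ereal_sup => _ [f Lf <-]; rewrite lee_fin.
  have /andP[ef0 _] := e01 n Lf.
  by rewrite ge0_ler_powR ?nnegrE ?ec.
rewrite lte_fin; apply: (@lt_le_trans _ _ (1 `^ n%:R^-1)%R); last by rewrite powR1.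
by rewrite gt0_ltr_powR ?nnegrE// invr_gt0 ltr0n.
Qed.

(** The limit exists and is the infimum of the rates, so a single [rate n] below 1 suffices. *)
Lemma spectral_gap_of_contraction n (rho : R) : (0 < n)%N -> (0 <= rho < 1)%R ->
  (forall f : T -> R, measurable_fun [set: T] f ->
    \int[mu]_x (f x ^+ 2)%:E < +oo -> \int[mu]_x (f x)%:E = 0 ->
    \int[mu]_x (iter n (markov_op p) f x ^+ 2)%:E <=
      rho%:E * \int[mu]_x (f x ^+ 2)%:E) ->
  L2_spectral_gap p mu.
Proof.
move=> n0 /andP[rho0 rho1] hrho; apply/L2_spectral_gapE.
have [L0|L0] := pselect (L2_normalized mu !=set0); last first.
  (* Without normalized functions every supremum is [-oo], and so is the limit. *)
  exists -oo; last exact: ltNyr.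
  have cvgNy (u : nat -> \bar R) : (forall k, u k = -oo) -> u @ \oo --> -oo.
    by move=> uE; rewrite (_ : u = cst -oo); [exact: cvg_cst|exact/funext].
  suff rateNy k : rate k = -oo by exact: cvgNy rateNy.
  rewrite /rate (_ : [set _ | _ in _] = set0) ?ereal_sup0//.
  by apply/seteqP; split => [t [f Lf _]|t []//]; apply: L0; exists f.
exists (ereal_inf [set rate k | k in [set k | (0 < k)%N]]).
  exact: cvg_submultiplicative_root.
apply: (@le_lt_trans _ _ (rate n)); first by apply: ereal_inf_lbound; exists n.
apply: (rate_lt1 (c := Num.sqrt rho)) => //.
  by rewrite sqrtr_ge0 -[ltRHS]sqrtr1 ltr_sqrt.
move=> f Lf; apply/e_le; rewrite ?sqrtr_ge0 ?sqr_sqrtr//.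
have /L2_normalizedP[mf f0 f1] := Lf.
have := hrho _ mf _ f0; rewrite f1 mule1; apply; exact: ltry.
Qed.

Lemma L2_spectral_gap_iter : L2_spectral_gap p mu ->
  exists N : nat, forall n, (N <= n)%N -> (0 < n)%N ->
    exists2 c : R, (0 <= c < 1)%R & forall f, L2_normalized mu f ->
      \int[mu]_x (iter n (markov_op p) f x ^+ 2)%:E <= c%:E.
Proof.
move=> /L2_spectral_gapE[l cvl l1].
have : \forall n \near \oo, rate n < 1 by exact: cvl (open_ereal_lt' l1).
move=> [N _ hN]; exists N => n Nn n0; have rn := hN n Nn.
have [L0|L0] := pselect (L2_normalized mu !=set0); last first.
  by exists 0%R; rewrite ?lexx ?ltr01// => f Lf; exfalso; apply: L0; exists f.
have e_rate f : L2_normalized mu f -> (e n f `^ n%:R^-1)%:E <= rate n.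
  by move=> Lf; apply: ereal_sup_ubound; exists f.
have rate0 : 0 <= rate n.
  have [f Lf] := L0; apply: le_trans (e_rate f Lf).
  by rewrite lee_fin powR_ge0.
case rE : (rate n) => [r| |]; move: rn rate0; rewrite rE // lte_fin lee_fin => r1 r0.
(* The norm is at most r^n, hence at most r because n > 0; the bound on second moments is its
   square. *)
exists (r ^+ 2)%R; first by rewrite sqr_ge0/= expr_lt1.
move=> f Lf; apply/e_le => //.
have /andP[ef0 _] := e01 n Lf.
have eE : ((e n f `^ n%:R^-1) ^+ n = e n f)%R.
  by rewrite -powR_mulrn ?powR_ge0// -powRrM mulVf ?powRr1// pnatr_eq0 -lt0n.
rewrite -eE; apply: (@le_trans _ _ (r ^+ n)%R).
  by rewrite ler_pXn2r// ?nnegrE ?powR_ge0// -lee_fin -rE e_rate.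
by rewrite ler_iXnr// ltW.
Qed.

(** The hypothesis is applied to the centred indicator of [A] divided by its standard deviation [s].
    With g(x) = p^m(x, A), it says that the variance of [g] is at most c mu(A) mu(A^c). *)
Lemma flow_ge_of_contraction m (c : R) :
  (forall f, L2_normalized mu f ->
    \int[mu]_x (iter m (markov_op p) f x ^+ 2)%:E <= c%:E) ->
  forall A, measurable A -> 0 < mu A < 1 ->
    ((1 - c) / 2)%:E * (mu A * mu (~` A)) <=
    \int[mu]_(x in A) nstep p m x (~` A).
Proof.
move=> hc A mA; have mCA := measurableC mA.
have [a aE] : exists a, mu A = a%:E.
  by exists (fine (mu A)); rewrite fineK// fin_num_measure.
rewrite probability_setC// aE !lte_fin => /andP[a0 a1].
have v0 : (0 < a * (1 - a))%R by rewrite mulr_gt0// subr_gt0.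
pose I x : R := \1_A x.
have mI : measurable_fun [set: T] I by exact: measurable_indic.
have I2 x : (I x ^+ 2 = I x)%R.
  by rewrite /I indicE; case: (_ \in _); rewrite ?expr1n ?expr0n.
have intI : \int[mu]_x (I x)%:E = a%:E by rewrite integral_indic// setIT.
have intI2 : \int[mu]_x (I x ^+ 2)%:E = a%:E by under eq_integral do rewrite I2.
have Iy : \int[mu]_x (I x ^+ 2)%:E < +oo by rewrite intI2 ltry.
pose g x : R := fine (nstep p m x A).
have gE x : nstep p m x A = (g x)%:E.
  by rewrite /g fineK// (fin_num_measure (kernel_prob (nstep p m) x)).
have mg : measurable_fun [set: T] g.
  apply: (measurableT_comp (fine_measurable _)) => //; exact: measurable_kernel.
have gM : g = markov_op (nstep p m) I.
  by apply/funext => x; rewrite /g /markov_op /Rintegral integral_indic ?setIT.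
have inv_m := nstep_invariant mu_inv m.
have gy : \int[mu]_x (g x ^+ 2)%:E < +oo.
  by rewrite gM (le_lt_trans (markov_op_contraction inv_m mI)).
have intg : \int[mu]_x (g x)%:E = a%:E.
  by rewrite -aE -(inv_m _ mA); apply: eq_integral => x _; rewrite gE.
pose s := Num.sqrt (a * (1 - a)).
have s0 : (0 < s)%R by rewrite sqrtr_gt0.
pose f x : R := (s^-1 * (I x - a))%R.
have mIa : measurable_fun [set: T] (fun x => I x - a)%R by exact: measurable_funB.
have intIa : \int[mu]_x (I x - a)%R%:E = 0.
  under eq_integral do rewrite EFinB.
  rewrite integralB//; last 2 first.
  - exact: integrable_of_sqr.
  - exact: finite_measure_integrable_cst.
  by rewrite intI integral_cst_probability subee.
have EIa : \int[mu]_x ((I x - a) ^+ 2)%:E = (a * (1 - a))%:E.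
  rewrite integral_sqr_shift// intI2 /Rintegral intI/= -EFinB -EFinD.
  by congr _%:E; ring.
have Iay : \int[mu]_x ((I x - a) ^+ 2)%:E < +oo by rewrite EIa ltry.
have Lf : L2_normalized mu f.
  apply/L2_normalizedP; split.
  - exact: measurable_funM.
  - under eq_integral do rewrite EFinM.
    by rewrite integralZl ?intIa ?mule0//; exact: integrable_of_sqr.
  - rewrite integral_sqrZ// EIa -EFinM exprVn sqr_sqrtr ?(ltW v0)//.
    by rewrite mulVf// gt_eqF.
have gle : \int[mu]_x ((g x - a) ^+ 2)%:E <= (c * (a * (1 - a)))%:E.
  have := hc _ Lf; rewrite iter_markov_opZ// integral_sqrZ; last first.
    exact: measurable_iter_markov_op.
  rewrite (ge0_ae_eq_integral (g := fun x => ((g x - a) ^+ 2)%:E))//; first last.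
  - have := iter_markov_op_ae mu_inv m (integrable_of_sqr mIa Iay).
    apply: filterS => x -> _; congr ((_ ^+ 2)%:E).
    rewrite gM /markov_op -kernel_probE RintegralB//; last 2 first.
    - apply: integrable_of_sqr => //; under eq_integral do rewrite I2.
      rewrite integral_indic// setIT.
      by rewrite (le_lt_trans (probability_le1 _ _))// ltry.
    - exact: finite_measure_integrable_cst.
    by rewrite {2}/Rintegral integral_cst_probability.
  - by move=> x _; rewrite lee_fin sqr_ge0.
  - by move=> x _; rewrite lee_fin sqr_ge0.
  - by apply: measurable_sqr; exact: measurable_funB.
  - by apply: measurable_sqr; exact: measurable_iter_markov_op.
  have s2 : (s ^+ 2 = a * (1 - a))%R by rewrite sqr_sqrtr ?(ltW v0).
  rewrite exprVn s2.
  case: (\int[mu]_x _) => [y| |]; last 2 first.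
  - by rewrite gt0_muley// lte_fin invr_gt0.
  - by rewrite leNye.
  by rewrite -EFinM !lee_fin ler_pdivrMl// mulrC.
have gC x : nstep p m x (~` A) = (1 - g x)%:E.
  by rewrite EFinB -gE -(probability_setC (kernel_prob (nstep p m) x)).
have g01 x : (0 <= g x <= 1)%R.
  rewrite -!lee_fin -gE measure_ge0/=.
  exact: (probability_le1 (kernel_prob (nstep p m) x)).
have -> : \int[mu]_(x in A) nstep p m x (~` A) = \int[mu]_x (I x * (1 - g x))%:E.
  rewrite integral_mkcond; apply: eq_integral => x _; rewrite patchE /I indicE.
  by case: ifPn => _; rewrite ?gC ?mul1r ?mul0r.
have I01 x : I x = 0%R \/ I x = 1%R.
  by rewrite /I indicE; case: (_ \in _); [right|left].
have mIg : measurable_fun [set: T] (fun x => (I x * (1 - g x))%:E).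
  by apply/measurable_EFinP/measurable_funM => //; exact: measurable_funB.
have Ig0 x : 0 <= (I x * (1 - g x))%:E.
  have /andP[_ g1] := g01 x.
  by rewrite lee_fin mulr_ge0 ?subr_ge0//; case: (I01 x) => ->.
(* [1_A <= 2 1_A (1 - g) + g^2] pointwise *)
have key : a%:E <= 2%:E * \int[mu]_x (I x * (1 - g x))%:E + \int[mu]_x (g x ^+ 2)%:E.
  rewrite -intI -ge0_integralZl// -ge0_integralD//; last 4 first.
  - by move=> x _; rewrite mule_ge0.
  - exact: measurable_funeM.
  - by move=> x _; rewrite lee_fin sqr_ge0.
  - exact: measurable_sqr.
  apply: ge0_le_integral => //.
  - by move=> x _; rewrite lee_fin; case: (I01 x) => ->.
  - exact/measurable_EFinP.
  - by apply: emeasurable_funD; [exact: measurable_funeM|exact: measurable_sqr].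
  move=> x _; rewrite -EFinM -EFinD lee_fin.
  have := sqr_ge0 (g x); have := sqr_ge0 (1 - g x)%R.
  by case: (I01 x) => ->; nra.
(* With y the flow and G the second moment of [g], it remains to combine a <= 2 y + G with G - a^2
   <= c a (1 - a). *)
move: gle; rewrite integral_sqr_shift// /Rintegral intg/=.
move: key gy; case: (\int[mu]_x (g x ^+ 2)%:E) => [G| |] //; last first.
  by rewrite addeNy leeNy_eq.
have : 0 <= \int[mu]_x (I x * (1 - g x))%:E by exact: integral_ge0.
case: (\int[mu]_x _) => [y| |] //; last by move=> *; rewrite leey.
rewrite -!EFinM -!EFinB -!EFinD !lee_fin => y0 key _ gle; nra.
Qed.

End spectral_gap.

(** * Both implications assembled *)

Theorem theorem1 (R : realType) (d : measure_display) (T : measurableType d)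
    (p : R.-pker T ~> T) (mu : probability T R) (n : nat) :
  (0 < n)%N ->
  positive_recurrent p mu ->
  equivalent_step_laws p mu n ->
  very_weak_reversible p mu n ->
  L2_spectral_gap p mu <-> 0 < isoperimetric_constant p mu (2 * n).
Proof.
move=> n0 [_ mu_inv _] eqv vwr; split => [gap|iso]; last first.
  have [rho rho01 hrho] := markov_op_L2_contraction mu_inv eqv vwr iso.
  exact: (spectral_gap_of_contraction mu_inv n0 rho01 hrho).
have [N hN] := L2_spectral_gap_iter mu_inv gap.
(* At least [N], so that P^m contracts, and a multiple of 2n, so that [flow_le_muln] applies with N
   + 1 blocks. *)
pose m := (2 * n * N.+1)%N.
have m_gt0 : (0 < m)%N by rewrite !muln_gt0 n0.
have Nm : (N <= m)%N by rewrite (leq_trans (leqnSn N))// leq_pmull// muln_gt0 n0.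
have [c /andP[c0 c1] hc] := hN _ Nm m_gt0.
(* The lower bound (1 - c) / 2 for m steps is shared among the N + 1 blocks of 2n steps. *)
apply: (@lt_le_trans _ _ ((1 - c) / 2 / N.+1%:R)%:E).
  by rewrite lte_fin !divr_gt0// subr_gt0.
apply: le_ereal_inf_tmp => _ [A [mA A01] <-].
have := le_trans (flow_ge_of_contraction mu_inv hc mA A01) (flow_le_muln mu_inv _ _ mA).
have [a aE] : exists a, mu A = a%:E.
  by exists (fine (mu A)); rewrite fineK// fin_num_measure.
move: A01; rewrite probability_setC; last exact: mA.
rewrite aE !lte_fin => /andP[a0 a1].
have v0 : (0 < a * (1 - a))%R by rewrite mulr_gt0// subr_gt0.
rewrite -EFinB -!EFinM inver gt_eqF// => h.
rewrite lee_pdivlMr// -EFinM; move: h.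
have : 0 <= \int[mu]_(x in A) nstep p (2 * n) x (~` A) by exact: integral_ge0.
case: (\int[mu]_(x in A) _) => [y| |] // _; last by move=> _; rewrite leey.
rewrite -EFinM !lee_fin => h.
by rewrite [leLHS]mulrAC ler_pdivrMr ?ltr0n// [leRHS]mulrC.
Qed.
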